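(* For any given constants $C>0$, $c_1\in(0,1/3)$ and $c_2\in(0,1)$, $$\liminf_{n\to\infty}\ n^{-(1/3-c_1)}\cdot\sup_{F\in\mathcal{F}_{\mathrm{Lip}}}\ \sup_{k\in\mathbb{N},\,\varepsilon>0}\ \log\frac{\sup_{p\in\mathcal{M}_k}\mathbb{P}_p\big(|F(p^{\mathrm{PML}})-F(p)|\ge C\varepsilon\big)}{\Big(\inf_{\widehat F}\sup_{p\in\mathcal{M}_k}\mathbb{P}_p\big(|\widehat F-F(p)|\ge\varepsilon\big)\Big)^{1-c_2}}=+\infty .$$
   Context: $\mathbb{N}$ is the set of positive integers and $[k]=\{1,\dots,k\}$. $\mathcal{M}_k$ is the set of all probability distributions $p=(p_1,\dots,p_k)$ on $[k]$. For $p\in\mathcal{M}_k$, $\mathbb{P}_p$ is the probability when $X^n=(X_1,\dots,X_n)$ are i.i.d. from $p$. The infimum over $\widehat F$ is over all real-valued estimators $\widehat F=\widehat F(X^n)$ (which may depend on $F,n,k,\varepsilon$ but not on $p$). $\mathcal{F}_{\mathrm{Lip}}$ is the class of all properties $F(p)=\sum_{i=1}^k f(p_i)$ with $f:[0,1]\to\mathbb{R}$ satisfying $|f(x)-f(y)|\le|x-y|$ for all $x,y\in[0,1]$ (the same $f$ defines $F$ on $\mathcal{M}_k$ for every $k$). Profile maximum likelihood (PML): the profile of $X_1,\dots,X_n\in[k]$ is the vector $\phi=(\phi_0,\dots,\phi_n)$, where $\phi_i$ is the number of $j\in[k]$ that appear exactly $i$ times in the sample. For $p\in\mathcal{M}_k$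 and a possible profile $\phi$, $\mathbb{P}(p,\phi)$ is the probability that $n$ i.i.d. samples from $p$ have profile $\phi$. The PML estimator is $p^{\mathrm{PML}}=p^{\mathrm{PML}}(\phi)\in\arg\max_{q\in\mathcal{M}_k}\mathbb{P}(q,\phi)$ (any fixed choice of maximizer), where $\phi$ is the profile of the observed sample $X^n$; $F(p^{\mathrm{PML}})$ is the plug-in estimator. Convention for the ratio: a ratio $a/0$ with $a>0$ is $+\infty$, and $(k,\varepsilon)$ for which the ratio is $0/0$ are omitted from the supremum; $\log 0=-\infty$. *)

(* Defs.v *)
From HB Require Import structures.
From mathcomp Require Import all_boot all_order all_algebra.
From mathcomp Require Import all_classical all_reals all_analysis.

Set Implicit Arguments.
Unset Strict Implicit.
Unset Printing Implicit Defensive.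

Import Order.TTheory GRing.Theory Num.Theory.

Local Open Scope classical_set_scope.
Local Open Scope ring_scope.

(* The symbols 1, ..., k are represented by 'I_k, so k must be positive for
   [simplex R k] to be nonempty. *)
Definition simplex (R : realType) (k : nat) : set ('I_k -> R) :=
  [set p | (forall j, 0 <= p j) /\ \sum_j p j = 1].
Arguments simplex : clear implicits.

(* Probability of the event A when the n coordinates of the sample are
   i.i.d. from p. *)
Definition iid_prob (R : realType) (n k : nat) (p : 'I_k -> R)
    (A : pred (n.-tuple 'I_k)) : R :=
  \sum_(x : n.-tuple 'I_k | A x) \prod_(i < n) p (tnth x i).

(* Only the values of f on [0, 1] matter: they are the only ones constrained
   here and the only ones [property f] uses on [simplex R k]. *)
Definition lip01 (R : realType) : set (R -> R) :=
  [set f | forall x y, 0 <= x <= 1 -> 0 <= y <= 1 -> `|f x - f y| <= `|x - y|].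
Arguments lip01 : clear implicits.

Definition property (R : realType) (f : R -> R) (k : nat) (p : 'I_k -> R) : R :=
  \sum_j f (p j).

Definition profile (n k : nat) (x : n.-tuple 'I_k) : {ffun 'I_n.+1 -> nat} :=
  [ffun i : 'I_n.+1 => #|[pred j : 'I_k | count_mem j x == i]|].

Definition profile_prob (R : realType) (n k : nat) (p : 'I_k -> R)
    (phi : {ffun 'I_n.+1 -> nat}) : R :=
  iid_prob p (fun x : n.-tuple 'I_k => profile x == phi).

(* A choice of one maximizer for each sample size n, alphabet size k and
   possible profile; the values at impossible profiles are irrelevant. *)
Definition is_PML (R : realType)
    (pml : forall n k : nat, {ffun 'I_n.+1 -> nat} -> 'I_k -> R) : Prop :=
  forall (n k : nat) (phi : {ffun 'I_n.+1 -> nat}), (0 < n)%N -> (0 < k)%N ->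
    (exists x : n.-tuple 'I_k, profile x = phi) ->
    simplex R k (pml n k phi) /\
    forall q, simplex R k q ->
      profile_prob q phi <= profile_prob (pml n k phi) phi.

Local Open Scope ereal_scope.

Definition worst_case_error (R : realType) (f : R -> R) (n k : nat)
    (Fhat : n.-tuple 'I_k -> R) (eps : R) : \bar R :=
  ereal_sup [set (iid_prob p
      (fun x : n.-tuple 'I_k => (eps <= `|Fhat x - property f p|)%R))%:E
    | p in simplex R k].

Definition minimax_error (R : realType) (f : R -> R) (n k : nat) (eps : R)
    : \bar R :=
  ereal_inf [set worst_case_error f Fhat eps
    | Fhat in [set: n.-tuple 'I_k -> R]].

Definition PML_error (R : realType)
    (pml : forall n k : nat, {ffun 'I_n.+1 -> nat} -> 'I_k -> R)
    (f : R -> R) (n k : nat) (eps : R) : \bar R :=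
  worst_case_error f
    (fun x : n.-tuple 'I_k => property f (pml n k (profile x))) eps.

(* The values log (num / den), where den = (minimax error) ^ (1 - c2), over the
   pairs (k, eps) for which the ratio is not 0 / 0. In [\bar R], 0^-1 = +oo, so
   that a / 0 = +oo for a > 0; moreover lne 0 = -oo and lne +oo = +oo. *)
Definition log_ratios (R : realType)
    (pml : forall n k : nat, {ffun 'I_n.+1 -> nat} -> 'I_k -> R)
    (C c2 : R) (f : R -> R) (n : nat) : set (\bar R) :=
  [set r | exists (k : nat) (eps : R),
    let num := PML_error pml f n k (C * eps)%R in
    let den := poweR (minimax_error f n k eps) (1 - c2)%R in
    [/\ (0 < k)%N, (0 < eps)%R, ~ (num = 0 /\ den = 0)
      & r = lne (num / den)]].

(* Main.v *)
Require Import Defs.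
From mathcomp Require Import all_boot all_order all_algebra.
From mathcomp Require Import all_classical all_reals all_analysis.
From mathcomp Require Import ring lra.

Set Implicit Arguments.
Unset Strict Implicit.
Unset Printing Implicit Defensive.

Import Order.TTheory GRing.Theory Num.Theory.
Import numFieldNormedType.Exports.

Local Open Scope classical_set_scope.
Local Open Scope ring_scope.

(* If h is 1-Lipschitz and f is its n-th Bernstein polynomial, then
   sum_j h(N_j / n), with N_j the counts of the sample, is an unbiased estimator
   of F(p) with differences bounded by 2 / n, so the minimax error at eps is at
   most 2 exp(- n eps^2 / 32). If all log-ratios were at most L, the plug-in
   q = p^PML would inherit these tails, to the power 1 - c2 and up to a factor
   exp L, for all such f.

   This is impossible when L is a small multiple of m ~ n^(1/3), whatever the
   estimator q of p is. Take m symbols of probability about 1 / m in disjoint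
   windows of width of order 1 / m^2, the exact position of the r-th one
   encoding a sign v_r at the scale 1 / sqrt(n m) of its statistical
   fluctuation. Plateau functions with arbitrary signs (the slow tests) have
   such high thresholds that a union bound over the 2^m patterns shows that q
   has about one symbol in each window; a signed sum of odd bumps (the fast test
   for the pattern v) then shows that q recovers v on average, so that most of
   the v_r could be decoded from the sample, against Assouad's lemma. *)

(** * Binomial expectations and Bernstein polynomials *)

(* The expectation of [g] at a binomial variable of parameters [n] and [x]. *)
Fixpoint bern (R : realType) (n : nat) (g : nat -> R) (x : R) : R :=
  if n is n'.+1 then
    x * bern n' (fun i => g i.+1) x + (1 - x) * bern n' g x
  else g 0%N.

Section Bern.
Variable R : realType.
Implicit Types (g : nat -> R) (x y : R) (n : nat).

Lemma bern_ext n g g' x : g =1 g' -> bern n g x = bern n g' x.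
Proof. by move=> /funext ->. Qed.

Lemma bernD n g g' x :
  bern n (fun i => g i + g' i) x = bern n g x + bern n g' x.
Proof. by elim: n g g' => [|n IH] g g' //=; rewrite !IH; ring. Qed.

Lemma bernZ n c g x : bern n (fun i => c * g i) x = c * bern n g x.
Proof. by elim: n g => [|n IH] g //=; rewrite !IH; ring. Qed.

Lemma bernB n g g' x :
  bern n (fun i => g i - g' i) x = bern n g x - bern n g' x.
Proof.
rewrite -[- bern n g' x]mulN1r -bernZ -bernD.
by apply: bern_ext => i; rewrite mulN1r.
Qed.

Lemma bern_cst n c x : bern n (fun=> c) x = c.
Proof. by elim: n => [|n IH] //=; rewrite !IH; ring. Qed.

Lemma bern_sum n (I : finType) (G : I -> nat -> R) x :
  bern n (fun i => \sum_r G r i) x = \sum_r bern n (G r) x.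
Proof.
elim: n G => [|n IH] G //=.
by rewrite !IH !mulr_sumr -big_split.
Qed.

Lemma bern_le n g g' x : 0 <= x <= 1 -> (forall i, g i <= g' i) ->
  bern n g x <= bern n g' x.
Proof.
move=> /andP[x0 x1]; elim: n g g' => [|n IH] g g' gg' //=.
by rewrite lerD // ler_wpM2l ?subr_ge0 // IH.
Qed.

Lemma bern_norm n g x : 0 <= x <= 1 -> `|bern n g x| <= bern n (fun i => `|g i|) x.
Proof.
move=> x01; rewrite ler_norml -mulN1r -bernZ; apply/andP; split.
  by apply: bern_le => // i; rewrite mulN1r lerNl -normrN ler_norm.
by apply: bern_le => // i; exact: ler_norm.
Qed.

(** Condition on one trial: changing its parameter costs [|x - y|] times the difference of the two
    continuations, an average of increments of [g]; the other trials are covered by induction. *)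
Lemma bern_lip n g x y L : 0 <= x <= 1 -> 0 <= y <= 1 ->
  (forall i, `|g i.+1 - g i| <= L) ->
  `|bern n g x - bern n g y| <= n%:R * L * `|x - y|.
Proof.
move=> /[dup] x01 /andP[x0 x1] /[dup] y01 /andP[y0 y1].
elim: n g => [|n IH] g gL; first by rewrite /= subrr normr0 !mul0r.
rewrite /=; set a := bern n _ x; set b := bern n g x.
set a' := bern n _ y; set b' := bern n g y.
have -> : x * a + (1 - x) * b - (y * a' + (1 - y) * b') =
  x * (a - a') + (1 - x) * (b - b') + (x - y) * (a' - b') by ring.
have haa : `|a - a'| <= n%:R * L * `|x - y| by apply: IH.
have hbb : `|b - b'| <= n%:R * L * `|x - y| by apply: IH.
have hab : `|a' - b'| <= L.
  rewrite /a' /b' -bernB (le_trans (bern_norm _ _ _)) //.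
  by rewrite -[leRHS](bern_cst n L y) bern_le.
rewrite (le_trans (ler_normD _ _)) // -natr1.
have -> : (n%:R + 1) * L * `|x - y| =
  (x * (n%:R * L * `|x - y|) + (1 - x) * (n%:R * L * `|x - y|)) + `|x - y| * L.
  by ring.
apply: lerD; last by rewrite normrM ler_wpM2l.
rewrite (le_trans (ler_normD _ _)) // !normrM.
rewrite (ger0_norm x0) (@ger0_norm _ (1 - x)) ?subr_ge0 //.
by apply: lerD; apply: ler_wpM2l => //; rewrite subr_ge0.
Qed.

(** Squared bias plus variance of the binomial law. *)
Lemma bern_sqr n c x :
  bern n (fun i => (i%:R - c) ^+ 2) x = (n%:R * x - c) ^+ 2 + n%:R * x * (1 - x).
Proof.
elim: n c => [|n IH] c /=; first by ring.
rewrite (@bern_ext n _ (fun i => (i%:R - (c - 1)) ^+ 2)); last first.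
  by move=> i; rewrite -natr1; ring.
by rewrite !IH -[n.+1%:R]natr1; ring.
Qed.

(** The Bernstein polynomial of [h]: at [x = p j], the mean of [h] at the empirical frequency of the
    symbol [j], by [iidE_count]. *)
Definition bernf n (h : R -> R) := bern n (fun i => h (i%:R / n%:R)).

Lemma bernf_sqr n c x : (0 < n)%N ->
  bernf n (fun u => (u - c) ^+ 2) x = (x - c) ^+ 2 + x * (1 - x) / n%:R.
Proof.
move=> n0; have n0' : n%:R != 0 :> R by rewrite pnatr_eq0 -lt0n.
rewrite /bernf (@bern_ext n _ (fun i => n%:R ^- 2 * (i%:R - n%:R * c) ^+ 2)).
  by rewrite bernZ bern_sqr; field.
by move=> i; field.
Qed.

Lemma bernf_le n h h' x : 0 <= x <= 1 -> (forall u, h u <= h' u) ->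
  bernf n h x <= bernf n h' x.
Proof. by move=> x01 hh'; apply: bern_le. Qed.

Lemma bernf_norm n h x : 0 <= x <= 1 ->
  `|bernf n h x| <= bernf n (fun u => `|h u|) x.
Proof. exact: bern_norm. Qed.

Lemma bernf_cst n c x : bernf n (fun=> c) x = c.
Proof. exact: bern_cst. Qed.

Lemma bernfZ n c h x : bernf n (fun u => c * h u) x = c * bernf n h x.
Proof. exact: bernZ. Qed.

Lemma bernfD n h h' x :
  bernf n (fun u => h u + h' u) x = bernf n h x + bernf n h' x.
Proof. exact: bernD. Qed.

Lemma bernfB n h h' x :
  bernf n (fun u => h u - h' u) x = bernf n h x - bernf n h' x.
Proof. exact: bernB. Qed.

Lemma bernf_sum n (I : finType) (G : I -> R -> R) x :
  bernf n (fun u => \sum_r G r u) x = \sum_r bernf n (G r) x.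
Proof. exact: bern_sum. Qed.

(** Smoothing keeps the Lipschitz constant: there are [n] trials, each with increments at most
    [1 / n]. *)
Lemma bernf_lip01 n h : (0 < n)%N -> (forall u u', `|h u - h u'| <= `|u - u'|) ->
  lip01 R (bernf n h).
Proof.
move=> n0 hL x y x01 y01.
have n0' : n%:R != 0 :> R by rewrite pnatr_eq0 -lt0n.
have := @bern_lip n (fun i => h (i%:R / n%:R)) x y n%:R^-1 x01 y01.
rewrite mulfV // mul1r; apply => i; rewrite (le_trans (hL _ _)) //.
by rewrite -natr1 mulrDl addrC addKr mul1r ger0_norm // invr_ge0.
Qed.

Lemma bern_continuous n g : continuous (bern n g).
Proof.
elim: n g => [|n IH] g x /=; first exact: cvg_cst.
apply: cvgD; apply: cvgM; try exact: IH; first exact: cvg_id.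
by apply: cvgB; [exact: cvg_cst|exact: cvg_id].
Qed.

End Bern.

(** * Product measures and concentration by bounded differences *)

Lemma tnth_cons (T : Type) n (x : T) (t : n.-tuple T) (i : 'I_n) :
  tnth (cons_tuple x t) (lift ord0 i) = tnth t i.
Proof. by rewrite (tnth_nth x) [RHS](tnth_nth x). Qed.

Definition iidE (R : realType) (n k : nat) (p : 'I_k -> R)
    (G : n.-tuple 'I_k -> R) : R :=
  \sum_(x : n.-tuple 'I_k) (\prod_(i < n) p (tnth x i)) * G x.

Section IidE.
Variable R : realType.
Implicit Types (n k : nat).

Lemma iidES n k (p : 'I_k -> R) (G : n.+1.-tuple 'I_k -> R) :
  iidE p G = \sum_j p j * iidE p (fun x => G (cons_tuple j x)).
Proof.
rewrite /iidE; under [RHS]eq_bigr do rewrite mulr_sumr.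
rewrite pair_bigA /=.
rewrite (reindex (fun jx : 'I_k * n.-tuple 'I_k => cons_tuple jx.1 jx.2)) /=.
  apply: eq_bigr => -[j x] _ /=; rewrite big_ord_recl mulrA; congr (_ * _ * _).
  by apply: eq_bigr => i _; rewrite tnth_cons.
exists (fun x : n.+1.-tuple 'I_k => (thead x, [tuple of behead x])).
  by move=> [j x] _ /=; rewrite theadE; congr pair; exact: val_inj.
by move=> x _ /=; rewrite [RHS]tuple_eta; exact: val_inj.
Qed.

Lemma iidE0 k (p : 'I_k -> R) (G : 0.-tuple 'I_k -> R) : iidE p G = G [tuple].
Proof.
rewrite /iidE (big_pred1 [tuple]) ?big_ord0 ?mul1r // => x.
by rewrite [x]tuple0 /= eqxx.
Qed.

Lemma iidED n k (p : 'I_k -> R) (G G' : n.-tuple 'I_k -> R) :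
  iidE p (fun x => G x + G' x) = iidE p G + iidE p G'.
Proof. by rewrite /iidE -big_split; apply: eq_bigr => x _; rewrite mulrDr. Qed.

Lemma iidEZ n k (p : 'I_k -> R) c (G : n.-tuple 'I_k -> R) :
  iidE p (fun x => c * G x) = c * iidE p G.
Proof. by rewrite /iidE mulr_sumr; apply: eq_bigr => x _; rewrite mulrCA. Qed.

Lemma iidEN n k (p : 'I_k -> R) (G : n.-tuple 'I_k -> R) :
  iidE p (fun x => - G x) = - iidE p G.
Proof. by rewrite /iidE -sumrN; apply: eq_bigr => x _; rewrite mulrN. Qed.

Lemma iidE_sum n k (p : 'I_k -> R) (I : finType) (G : I -> n.-tuple 'I_k -> R) :
  iidE p (fun x => \sum_r G r x) = \sum_r iidE p (G r).
Proof.
rewrite /iidE exchange_big /=.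
by apply: eq_bigr => x _; rewrite mulr_sumr.
Qed.

Lemma iidE_ge0 n k (p : 'I_k -> R) (G : n.-tuple 'I_k -> R) :
  (forall j, 0 <= p j) -> (forall x, 0 <= G x) -> 0 <= iidE p G.
Proof.
move=> p0 G0; apply: sumr_ge0 => x _; apply: mulr_ge0 => //.
exact: prodr_ge0.
Qed.

Lemma iidE_le n k (p : 'I_k -> R) (G G' : n.-tuple 'I_k -> R) :
  (forall j, 0 <= p j) -> (forall x, G x <= G' x) -> iidE p G <= iidE p G'.
Proof.
move=> p0 GG'; apply: ler_sum => x _; apply: ler_wpM2l => //.
exact: prodr_ge0.
Qed.

(** General weights are allowed because [two_point] applies this to [p j ^+ 2 / q j], whose total
    mass is a chi-square sum. *)
Lemma iidE1 n k (p : 'I_k -> R) :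
  iidE p (fun _ : n.-tuple 'I_k => 1) = (\sum_j p j) ^+ n.
Proof.
elim: n => [|n IH]; first by rewrite iidE0.
by rewrite iidES exprS mulr_suml; apply: eq_bigr => j _; rewrite IH.
Qed.

Lemma iidE_cst n k (p : 'I_k -> R) c : simplex R k p ->
  iidE p (fun _ : n.-tuple 'I_k => c) = c.
Proof.
move=> [_ p1]; have := iidEZ p c (fun _ : n.-tuple 'I_k => 1).
by rewrite iidE1 p1 expr1n mulr1 => ->.
Qed.

Lemma iid_probE n k (p : 'I_k -> R) (A : pred (n.-tuple 'I_k)) :
  iid_prob p A = iidE p (fun x => (A x)%:R).
Proof.
rewrite /iid_prob /iidE big_mkcond /=; apply: eq_bigr => x _.
by case: (A x); rewrite ?mulr1 ?mulr0.
Qed.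

(** Only a first draw equal to [j] shifts the count; the other draws have total mass [1 - p j]. *)
Lemma iidE_count n k (p : 'I_k -> R) (j : 'I_k) (g : nat -> R) : simplex R k p ->
  iidE p (fun x : n.-tuple 'I_k => g (count_mem j x)) = bern n g (p j).
Proof.
move=> [p0 p1]; elim: n g => [|n IH] g; first by rewrite iidE0.
rewrite iidES (eq_bigr (fun i =>
    p i * bern n (fun m => g ((i == j) + m)%N) (p j))); last first.
  by move=> i _; rewrite -IH.
rewrite (bigD1 j) //= eqxx; congr (_ + _).
rewrite (eq_bigr (fun i => p i * bern n g (p j))); last first.
  by move=> i /negPf ij; rewrite ij.
rewrite -mulr_suml; congr (_ * _); apply/eqP.
by rewrite eq_sym subr_eq -p1 (bigD1 j) //= addrC.
Qed.

(* [expR y = 1 / expR (- y) <= 1 / (1 - y)] *)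
Lemma expR_le_quad (y : R) : y <= 1 / 2 -> expR y <= 1 + y + 2 * y ^+ 2.
Proof.
move=> y2; have y1 : 0 < 1 - y by lra.
rewrite -[y in expR y]opprK expRN -[leRHS]invrK lef_pV2 ?posrE ?expR_gt0 //.
  rewrite (le_trans _ (expR_ge1Dx _)) // -[leLHS]mul1r ler_pdivrMr; nra.
rewrite invr_gt0; nra.
Qed.

(** Martingale argument: the mean [mu j] given the first draw is within [c] of the overall mean, so
    this draw costs a factor of at most [1 + 2 * (l * c) ^+ 2]; induction covers the remaining
    draws. *)
Lemma iidE_expR_le n k (p : 'I_k -> R) (G : n.-tuple 'I_k -> R) (c l : R) :
  simplex R k p -> 0 <= l -> 0 <= c -> l * c <= 1 / 2 ->
  (forall (i : 'I_n) (x y : n.-tuple 'I_k),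
     (forall i', i' != i -> tnth x i' = tnth y i') -> `|G x - G y| <= c) ->
  iidE p (fun x => expR (l * (G x - iidE p G))) <= expR (n%:R * (2 * (l * c) ^+ 2)).
Proof.
move=> /[dup] ps [p0 p1] l0 c0 lc; elim: n G => [|n IH] G Gc.
  by rewrite !iidE0 subrr mulr0 mul0r.
pose mu j := iidE p (fun x => G (cons_tuple j x)).
have muc j j' : `|mu j - mu j'| <= c.
  rewrite -(@iidE_cst n _ p c ps) /mu -iidEN -iidED ler_norml -iidEN.
  have H x : `|G (cons_tuple j x) - G (cons_tuple j' x)| <= c.
    apply: (Gc ord0) => i' i'0; have [m ->|i'E] := unliftP ord0 i'; first by rewrite !tnth_cons.
    by rewrite i'E eqxx in i'0.
  apply/andP; split; apply: iidE_le => // x; have := H x; rewrite ler_norml => /andP[] //.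
have GE : iidE p G = \sum_j p j * mu j by rewrite iidES.
have mucG j : `|mu j - iidE p G| <= c.
  have -> : mu j - iidE p G = \sum_j' p j' * (mu j - mu j').
    rewrite GE; under [RHS]eq_bigr do rewrite mulrBr.
    by rewrite sumrB -mulr_suml p1 mul1r.
  rewrite (le_trans (ler_norm_sum _ _ _)) //.
  rewrite -[leRHS]mul1r -p1 mulr_suml ler_sum // => j' _.
  by rewrite normrM ger0_norm // ler_wpM2l.
rewrite iidES -natr1 mulrDl mul1r expRD mulrC.
apply: (@le_trans _ _ (\sum_j p j * (expR (l * (mu j - iidE p G)) *
    expR (n%:R * (2 * (l * c) ^+ 2))))).
  apply: ler_sum => j _; apply: ler_wpM2l => //.
  rewrite -[X in X <= _]/(iidE p (fun x => expR (l * (G (cons_tuple j x) - iidE p G)))).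
  have -> : (fun x : n.-tuple 'I_k => expR (l * (G (cons_tuple j x) - iidE p G))) =
    (fun x => expR (l * (mu j - iidE p G)) * expR (l * (G (cons_tuple j x) - mu j))).
    by apply/funext => x; rewrite -expRD -mulrDr; congr (expR (l * _)); ring.
  rewrite iidEZ ler_wpM2l ?expR_ge0 //; apply: IH => i x y xy.
  apply: (Gc (lift ord0 i)) => i' i'i.
  have [m mE|->//] := unliftP ord0 i'; rewrite mE !tnth_cons; apply: xy.
  by apply: contra_neq i'i => mi; rewrite mE mi.
under eq_bigr do rewrite mulrA.
rewrite -mulr_suml ler_wpM2r ?expR_ge0 //.
(* The linear term will vanish, since the [mu j] average to [iidE p G]. *)
apply: (@le_trans _ _ (\sum_j (p j + l * (p j * (mu j - iidE p G)) + p j * (2 * (l * c) ^+ 2)))).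
  apply: ler_sum => j _; have := mucG j; rewrite ler_norml => /andP[h1 h2].
  have le1 : l * (mu j - iidE p G) <= l * c by rewrite ler_wpM2l.
  have ge1 : - (l * c) <= l * (mu j - iidE p G) by rewrite -mulrN ler_wpM2l.
  have : p j * expR (l * (mu j - iidE p G)) <=
    p j * (1 + l * (mu j - iidE p G) + 2 * (l * c) ^+ 2).
    rewrite ler_wpM2l // (le_trans (expR_le_quad _)) ?(le_trans le1) //.
    rewrite lerD2l ler_wpM2l //; nra.
  by move/le_trans; apply; rewrite le_eqVlt; apply/orP; left; apply/eqP; ring.
rewrite !big_split /= -mulr_sumr p1.
have -> : \sum_i p i * (mu i - iidE p G) = 0.
  under eq_bigr do rewrite mulrBr.
  by rewrite sumrB -mulr_suml p1 mul1r GE subrr.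
by rewrite mulr0 addr0 -mulr_suml p1 mul1r expR_ge1Dx.
Qed.

Lemma markov_expR n k (p : 'I_k -> R) (G : n.-tuple 'I_k -> R) (t : R) :
  (forall j, 0 <= p j) ->
  iid_prob p (fun x => t <= G x) <= expR (- t) * iidE p (fun x => expR (G x)).
Proof.
move=> p0; rewrite iid_probE -iidEZ; apply: iidE_le => // x.
case: (leP t (G x)) => [tG|_]; last by rewrite mulr_ge0 ?expR_ge0.
by rewrite -expRD -expR0 ler_expR; lra.
Qed.

(** McDiarmid's inequality up to the constant, with the Chernoff parameter [l] left free; the factor
    2 comes from the one-sided bounds for [G] and [- G]. *)
Lemma bounded_differences n k (p : 'I_k -> R) (G : n.-tuple 'I_k -> R) (c l t : R) :
  simplex R k p -> 0 <= l -> 0 <= c -> l * c <= 1 / 2 ->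
  (forall (i : 'I_n) (x y : n.-tuple 'I_k),
     (forall i', i' != i -> tnth x i' = tnth y i') -> `|G x - G y| <= c) ->
  iid_prob p (fun x => t <= `|G x - iidE p G|) <=
    2 * expR (n%:R * (2 * (l * c) ^+ 2) - l * t).
Proof.
move=> /[dup] ps [p0 p1] l0 c0 lc Gc.
have one (H : n.-tuple 'I_k -> R) : (forall (i : 'I_n) (x y : n.-tuple 'I_k),
     (forall i', i' != i -> tnth x i' = tnth y i') -> `|H x - H y| <= c) ->
  iid_prob p (fun x => l * t <= l * (H x - iidE p H)) <=
    expR (n%:R * (2 * (l * c) ^+ 2) - l * t).
  move=> Hc; rewrite (le_trans (markov_expR _ _ _)) // expRD mulrC.
  by rewrite ler_wpM2r ?expR_ge0 // iidE_expR_le.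
have NGc (i : 'I_n) (x y : n.-tuple 'I_k) :
    (forall i', i' != i -> tnth x i' = tnth y i') -> `|- G x - - G y| <= c.
  by move=> xy; rewrite -opprD normrN (Gc i).
rewrite mulr_natl mulr2n; apply: le_trans _ (lerD (one _ Gc) (one _ NGc)).
rewrite !iid_probE -iidED; apply: iidE_le => // x.
case: (leP t `|G x - iidE p G|) => [|_]; last by rewrite addr_ge0.
rewrite iidEN -opprD ler_normr => /orP[] h.
  by rewrite (ler_wpM2l l0 h) lerDl.
by rewrite (ler_wpM2l l0 h) lerDr.
Qed.

End IidE.

(** * Minimax upper bound and its transfer to the plug-in estimator *)

Section Minimax.
Variable R : realType.

Lemma count_mem_sum n k (x : n.-tuple 'I_k) j :
  count_mem j x = (\sum_(i < n) (tnth x i == j))%N.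
Proof. by rewrite -sum1_count big_mkcond big_tuple; apply: eq_bigr => i _ /=; case: (_ == _). Qed.

Lemma minimax_bernf n k (h : R -> R) (eps : R) : (0 < n)%N ->
  (forall u u', `|h u - h u'| <= `|u - u'|) -> 0 < eps <= 1 ->
  (minimax_error (bernf n h) n k eps <= (2 * expR (- (n%:R * eps ^+ 2 / 32)))%:E)%E.
Proof.
move=> n0 hL /andP[e0 e1].
have n0' : 0 < n%:R :> R by rewrite ltr0n.
pose T (x : n.-tuple 'I_k) := \sum_j h ((count_mem j x)%:R / n%:R).
apply: ge_ereal_inf; exists (worst_case_error (bernf n h) T eps); first by exists T.
apply: ge_ereal_sup => _ [p ps <-]; rewrite lee_fin.
have ET : iidE p T = property (bernf n h) p.
  rewrite /T iidE_sum; apply: eq_bigr => j _.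
  by rewrite /bernf -(@iidE_count R n k p j (fun i => h (i%:R / n%:R)) ps).
have Tc (i : 'I_n) (x y : n.-tuple 'I_k) :
    (forall i', i' != i -> tnth x i' = tnth y i') -> `|T x - T y| <= 2 / n%:R.
  move=> xy; rewrite /T -sumrB (le_trans (ler_norm_sum _ _ _)) //.
  have step j : `|h ((count_mem j x)%:R / n%:R) - h ((count_mem j y)%:R / n%:R)| <=
      ((tnth x i == j)%:R + (tnth y i == j)%:R) / n%:R.
    rewrite (le_trans (hL _ _)) // -mulrBl normrM (@ger0_norm _ n%:R^-1) ?invr_ge0 ?(ltW n0') //.
    rewrite ler_wpM2r ?invr_ge0 ?(ltW n0') //.
    have cE (z : n.-tuple 'I_k) : count_mem j z =
        ((tnth z i == j) + \sum_(i' < n | i' != i) (tnth z i' == j))%N.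
      by rewrite count_mem_sum (bigD1 i).
    have cxy : (\sum_(i' < n | i' != i) (tnth y i' == j) =
        \sum_(i' < n | i' != i) (tnth x i' == j))%N.
      by apply: eq_bigr => i' i'i; rewrite xy.
    rewrite !cE cxy !natrD opprD addrACA subrr addr0.
    by case: (_ == j); case: (_ == j); rewrite ?subrr ?subr0 ?sub0r ?normrN ?normr0 ?normr1 ?addr0 ?add0r.
  rewrite (le_trans (ler_sum _ (fun j _ => step j))) // -mulr_suml.
  rewrite ler_wpM2r ?invr_ge0 ?(ltW n0') // big_split /=.
  have s1 a : \sum_(j < k) (a == j)%:R = 1 :> R.
    by rewrite (bigD1 a) //= eqxx big1 ?addr0 // => j /negPf; rewrite eq_sym => ->.
  by rewrite !s1.
(* With [c = 2 / n] the exponent is [8 * l ^+ 2 / n - l * eps], minimal at [l = n * eps / 16]; then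
   [l * c = eps / 8] is small enough because [eps <= 1]. *)
have := @bounded_differences R n k p T (2 / n%:R) (n%:R * eps / 16) eps ps.
rewrite ET => H; apply: le_trans (H _ _ _ Tc) _.
- by rewrite divr_ge0 // mulr_ge0 // ltW.
- by rewrite divr_ge0 // ltW.
- have -> : n%:R * eps / 16 * (2 / n%:R) = eps / 8 by field; rewrite gt_eqF.
  lra.
have -> : n%:R * eps / 16 * (2 / n%:R) = eps / 8 by field; rewrite gt_eqF.
by rewrite ler_pM2l // ler_expR le_eqVlt; apply/orP; left; apply/eqP; field.
Qed.

Lemma PML_tail pml (C c2 L : R) n k (h : R -> R) (eps : R)
    (p : 'I_k -> R) : (0 < n)%N -> (0 < k)%N -> 0 < c2 < 1 ->
  (forall f, lip01 R f -> (ereal_sup (log_ratios pml C c2 f n) <= L%:E)%E) ->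
  (forall u u', `|h u - h u'| <= `|u - u'|) -> 0 < eps <= 1 -> simplex R k p ->
  iid_prob p (fun x : n.-tuple 'I_k =>
    C * eps <= `|property (bernf n h) (pml n k (profile x)) - property (bernf n h) p|)
  <= 2 * expR (L - (1 - c2) * (n%:R * eps ^+ 2 / 32)).
Proof.
move=> n0 k0 /andP[c20 c21] HL hL /[dup] e01 /andP[e0 e1] ps.
have := HL _ (bernf_lip01 n0 hL).
set f := bernf n h; set A := iid_prob p _.
set num := PML_error pml f n k (C * eps).
set den := poweR (minimax_error f n k eps) (1 - c2).
move=> sL.
have Anum : (A%:E <= num)%E by apply: ereal_sup_ubound; exists p.
have mm := minimax_bernf k n0 hL e01.
have A0 : 0 <= A by rewrite /A iid_probE; apply: iidE_ge0 => //; case: ps.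
(* Once [A > 0] the numerator is positive, so the pair is not a discarded [0 / 0]. *)
have [A00|Apos] := eqVneq A 0; first by rewrite A00 mulr_ge0 ?expR_ge0.
have {Apos}Apos : 0 < A by rewrite lt_neqAle eq_sym Apos.
have num0 : (0 < num)%E by rewrite (lt_le_trans _ Anum) ?lte_fin.
have sup : (lne (num / den) <= L%:E)%E.
  apply: le_trans sL; apply: ereal_sup_ubound; exists k, eps; split => //.
  by move=> -[n00 _]; move: num0; rewrite /num /= n00 ltxx.
have mm0 : (0 <= minimax_error f n k eps)%E.
  apply: le_ereal_inf_tmp => _ [F _ <-].
  apply: (@le_trans _ _ (iid_prob p (fun x => eps <= `|F x - property f p|)%R)%:E).
    by rewrite lee_fin iid_probE; apply: iidE_ge0 => //; case: ps.
  by apply: ereal_sup_ubound; exists p.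
have mmf : minimax_error f n k eps \is a fin_num.
  by rewrite ge0_fin_numE // (le_lt_trans mm) ?ltry.
move: sup mm mm0; rewrite /den -(fineK mmf); set d := fine _ => sup mm mm0.
rewrite lee_fin in mm; rewrite lee_fin in mm0.
have c2' : 0 < 1 - c2 by rewrite subr_gt0.
move: sup; rewrite poweR_EFin; set D := d `^ (1 - c2) => sup.
(* A zero denominator would make the log-ratio [+oo], against the bound [L]. *)
have [D0|Dn0] := eqVneq D 0.
  by move: sup; rewrite D0 inve0 gt0_muley.
have D0 : 0 < D by rewrite lt_neqAle eq_sym Dn0 powR_ge0.
have ADL : ln (A / D) <= L.
  rewrite -lee_fin -lne_EFin ?divr_gt0 // (le_trans _ sup) //.
  rewrite lee_lne ?in_itv /= ?andbT ?leey ?lee_fin ?divr_ge0 ?(ltW D0) //.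
    by rewrite inver (negPf Dn0) EFinM lee_wpmul2r // lee_fin invr_ge0 ltW.
  by rewrite mule_ge0 ?(ltW num0) // inver (negPf Dn0) lee_fin invr_ge0 ltW.
have AD : A <= D * expR L.
  rewrite mulrC -ler_pdivrMr // -[leLHS]lnK ?ler_expR //.
  by rewrite posrE divr_gt0.
rewrite (le_trans AD) // expRD mulrCA mulrC ler_wpM2l ?expR_ge0 //.
apply: (@le_trans _ _ ((2 * expR (- (n%:R * eps ^+ 2 / 32))) `^ (1 - c2))).
  by rewrite ge0_ler_powR ?nnegrE ?(ltW c2') // mulr_ge0 ?expR_ge0.
rewrite powRM ?expR_ge0 // -expRM mulNr [_ * (1 - c2)]mulrC ler_wpM2r ?expR_ge0 //.
by rewrite ler1_powR ?ler1n // gerBl ltW.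
Qed.

End Minimax.

(** * Tents, odd bumps and plateaus *)

Section Bumps.
Variable R : realType.
Implicit Types (w rho x y u : R).

Lemma sum_disjoint_le (I : finType) (F : I -> R) (c : R) : 0 <= c ->
  (forall r, F r <= c) -> (forall r r', F r != 0 -> F r' != 0 -> r = r') ->
  \sum_r F r <= c.
Proof.
move=> c0 Fc Fd; have [/existsP[r Fr]|/existsPn F0] := boolP [exists r, F r != 0].
  rewrite (bigD1 r) //= big1 ?addr0 // => r' r'r.
  by apply/eqP; apply: contraNT r'r => Fr'; rewrite (Fd r' r).
by rewrite big1 // => r _; apply/eqP; move: (F0 r); rewrite negbK.
Qed.

(** At most one bump is active at [u] and at most one at [u'], so at most two terms change: hence
    the factor 2. *)
Lemma disjoint_lip (I : finType) (G : I -> R -> R) (s : I -> R) (L u u' : R) :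
  0 <= L -> (forall r, `|s r| <= 1) ->
  (forall r u u', `|G r u - G r u'| <= L * `|u - u'|) ->
  (forall u r r', G r u != 0 -> G r' u != 0 -> r = r') ->
  `|\sum_r s r * G r u - \sum_r s r * G r u'| <= 2 * L * `|u - u'|.
Proof.
move=> L0 s1 GL Gd; rewrite -sumrB (le_trans (ler_norm_sum _ _ _)) //.
have Lu : 0 <= L * `|u - u'| by rewrite mulr_ge0.
have b1 z : \sum_r (if G r z != 0 then L * `|u - u'| else 0) <= L * `|u - u'|.
  apply: sum_disjoint_le; first by [].
    by move=> r; case: ifPn.
  move=> r r'.
  case: ifPn => [Gr _|_]; last by rewrite eqxx.
  case: ifPn => [Gr' _|_]; last by rewrite eqxx.
  exact: Gd Gr Gr'.
rewrite -mulrA mulr_natl mulr2n; apply: le_trans _ (lerD (b1 u) (b1 u')).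
rewrite -big_split; apply: ler_sum => r _ /=.
rewrite -mulrBr normrM.
have : `|s r| * `|G r u - G r u'| <= L * `|u - u'|.
  by rewrite -[leRHS]mul1r ler_pM.
case: ifPn => [_|]; first by move/le_trans; apply; rewrite lerDl; case: ifP.
rewrite negbK => /eqP ->; case: ifPn => [_|]; first by rewrite [0 + L * _]add0r.
by rewrite negbK => /eqP -> _; rewrite subrr normr0 mulr0 addr0.
Qed.

Definition tent w u := Num.max 0 (w - `|u|).

Lemma tent_lip w u u' : `|tent w u - tent w u'| <= `|u - u'|.
Proof.
have h1 := lerB_dist u u'; have h2 := lerB_dist u' u.
rewrite distrC in h2.
by rewrite /tent ler_norml; apply/andP; split;
  case: (lerP 0 (w - `|u|)) => ?; case: (lerP 0 (w - `|u'|)) => ?; lra.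
Qed.

Lemma tent_ge0 w u : 0 <= tent w u.
Proof. by rewrite /tent le_max lexx. Qed.

Lemma tent_le w u : 0 <= w -> tent w u <= w.
Proof. by move=> w0; rewrite /tent ge_max w0 gerBl normr_ge0. Qed.

Lemma tent_out w u : w <= `|u| -> tent w u = 0.
Proof. by move=> wu; rewrite /tent; apply/max_idPl; rewrite subr_le0. Qed.

(** For [w > 0], an odd bump about [y]: it vanishes beyond distance [2 * w], and its extreme values
    [w] and [- w] are reached at [y - w] and [y + w]. *)
Definition fast w y u := tent w (u - (y - w)) - tent w (u - (y + w)).

Lemma fast_lip w y u u' : `|fast w y u - fast w y u'| <= 2 * `|u - u'|.
Proof.
have h1 := tent_lip w (u - (y - w)) (u' - (y - w)).
have h2 := tent_lip w (u - (y + w)) (u' - (y + w)).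
move: h1 h2; rewrite (_ : _ - _ - (_ - _) = u - u'); last by ring.
rewrite (_ : u - _ - (_ - _) = u - u'); last by ring.
rewrite /fast !ler_norml => /andP[? ?] /andP[? ?].
by apply/andP; split; lra.
Qed.

Lemma fast_le w y u : 0 <= w -> `|fast w y u| <= w.
Proof.
move=> w0; rewrite /fast ler_norml.
have := tent_le (u - (y - w)) w0; have := tent_le (u - (y + w)) w0.
have := tent_ge0 w (u - (y - w)); have := tent_ge0 w (u - (y + w)).
by move=> *; apply/andP; split; lra.
Qed.

Lemma fast_out w y u : 0 <= w -> 2 * w <= `|u - y| -> fast w y u = 0.
Proof.
move=> w0 uy; have wE : `|w| = w by rewrite ger0_norm.
rewrite /fast !tent_out ?subrr //.
  rewrite opprD addrA; have := lerB_dist (u - y) w; rewrite wE; lra.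
rewrite opprB addrA addrAC -[w in leRHS]opprK.
have := lerB_dist (u - y) (- w); rewrite normrN wE; lra.
Qed.

Lemma fast_peak w y (b : bool) : 0 <= w -> (-1) ^+ b * fast w y (y - (-1) ^+ b * w) = w.
Proof.
move=> w0; have e0 : tent w 0 = w by rewrite /tent normr0 subr0; apply/max_idPr.
have e1 : tent w (2 * w) = 0 by rewrite tent_out // ger0_norm; lra.
have e2 : tent w (- (2 * w)) = 0 by rewrite tent_out // normrN ger0_norm; lra.
rewrite /fast; case: b; rewrite /= ?expr1 ?expr0.
  rewrite (_ : y - -1 * w - (y - w) = 2 * w); last by ring.
  rewrite (_ : y - -1 * w - (y + w) = 0); last by ring.
  by rewrite e0 e1; ring.
rewrite (_ : y - 1 * w - (y - w) = 0); last by ring.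
rewrite (_ : y - 1 * w - (y + w) = - (2 * w)); last by ring.
by rewrite e0 e2; ring.
Qed.

(** For [rho > 0], a trapezoid equal to 1 up to distance [rho] from [y] and to 0 beyond
    [2 * rho]. *)
Definition plateau rho y u := Num.min 1 (Num.max 0 (2 - `|u - y| / rho)).

Lemma plateau_ge0 rho y u : 0 <= plateau rho y u.
Proof. by rewrite /plateau le_min ler01 le_max lexx. Qed.

Lemma plateau_le1 rho y u : plateau rho y u <= 1.
Proof. by rewrite /plateau ge_min lexx. Qed.

Lemma plateau_in rho y u : 0 < rho -> `|u - y| <= rho -> plateau rho y u = 1.
Proof.
move=> r0 uy; rewrite /plateau; apply/min_idPl; rewrite le_max; apply/orP; right.
have : `|u - y| / rho <= 1 by rewrite ler_pdivrMr // mul1r.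
lra.
Qed.

Lemma plateau_out rho y u : 0 < rho -> 2 * rho <= `|u - y| -> plateau rho y u = 0.
Proof.
move=> r0 uy; have uy' : 2 <= `|u - y| / rho by rewrite ler_pdivlMr.
rewrite /plateau (_ : Num.max 0 _ = 0); last by apply/max_idPl; lra.
by apply/min_idPr.
Qed.

Lemma plateau_lip rho y u u' : 0 < rho ->
  `|plateau rho y u - plateau rho y u'| <= rho^-1 * `|u - u'|.
Proof.
move=> r0; have ir0 : 0 <= rho^-1 by rewrite invr_ge0 ltW.
have dE : u - y - (u' - y) = u - u' by ring.
have := lerB_dist (u - y) (u' - y); have := lerB_dist (u' - y) (u - y).
rewrite distrC dE => /(ler_wpM2l ir0) + /(ler_wpM2l ir0).
rewrite /plateau ler_norml !mulrBr ![rho^-1 * _]mulrC.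
set s := `|u - y| / rho; set s' := `|u' - y| / rho.
have maxE (z : R) : (0 <= z /\ Num.max 0 z = z) \/ (z <= 0 /\ Num.max 0 z = 0).
  by case: (lerP 0 z) => z0; [left|right; rewrite ltW].
move: (Num.max 0 (2 - s)) (Num.max 0 (2 - s')) (maxE (2 - s)) (maxE (2 - s')).
move=> t t' ht ht' ? ?.
by apply/andP; split; case: (lerP 1 t) => ?; case: (lerP 1 t') => ?;
  case: ht => -[? ?]; case: ht' => -[? ?]; lra.
Qed.

End Bumps.

(** * Second-moment estimates for the smoothed bumps *)

Section BumpBernstein.
Variables (R : realType) (n : nat).
Hypothesis n0 : (0 < n)%N.
Implicit Types (w rho x y u : R).

Let nR : 0 < n%:R :> R. Proof. by rewrite ltr0n. Qed.

Lemma bernf_ge0 h x : 0 <= x <= 1 -> (forall u, 0 <= h u) -> 0 <= bernf n h x.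
Proof. by move=> x01 h0; rewrite -(bernf_cst n 0 x); apply: bernf_le. Qed.

Lemma bernf_var x : 0 <= x <= 1 -> bernf n (fun u => (u - x) ^+ 2) x <= x / n%:R.
Proof.
move=> /andP[x0 x1]; rewrite bernf_sqr // subrr expr0n add0r.
by rewrite ler_wpM2r ?invr_ge0 ?(ltW nR) //; nra.
Qed.

Lemma one_sub_plateau rho y u : 0 < rho ->
  1 - plateau rho y u <= ((u - y) / rho) ^+ 2.
Proof.
move=> r0; have [uy|uy] := leP `|u - y| rho.
  by rewrite plateau_in // subrr sqr_ge0.
apply: (@le_trans _ _ 1); first by rewrite gerBl plateau_ge0.
rewrite -real_normK ?num_real // exprn_ege1 // normrM normfV (gtr0_norm r0).
by rewrite ler_pdivlMr // mul1r ltW.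
Qed.

(** Chebyshev's inequality: the defect of the plateau lies below a parabola, whose Bernstein
    polynomial is explicit. *)
Lemma bernf_plateau rho y x : 0 < rho -> 0 <= x <= 1 ->
  1 - bernf n (plateau rho y) x <= ((x - y) ^+ 2 + x / n%:R) / rho ^+ 2.
Proof.
move=> r0 /[dup] x01 /andP[x0 x1].
rewrite -[X in X - _](bernf_cst n 1 x) -bernfB.
apply: (@le_trans _ _ (bernf n (fun u => rho ^- 2 * (u - y) ^+ 2) x)).
  apply: bernf_le => // u; rewrite (le_trans (one_sub_plateau _ _ _)) //.
  by rewrite exprMn exprVn mulrC.
rewrite bernfZ mulrC; apply: ler_wpM2r; first by rewrite invr_ge0 exprn_ge0 // ltW.
rewrite bernf_sqr // lerD2l; apply: ler_wpM2r; first by rewrite invr_ge0 ltW.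
nra.
Qed.

Lemma bernf_fast_le w rho y x : 0 < w -> 0 < rho -> 2 * w <= rho -> 0 <= x <= 1 ->
  bernf n (fun u => `|fast w y u|) x <= w * bernf n (plateau rho y) x.
Proof.
move=> w0 r0 wr x01; rewrite -bernfZ; apply: bernf_le => // u.
have [uy|uy] := leP `|u - y| rho.
  by rewrite plateau_in // mulr1 fast_le // ltW.
by rewrite fast_out ?normr0 ?mulr_ge0 ?plateau_ge0 ?(ltW w0) // (le_trans wr) // ltW.
Qed.

(** Chebyshev again: a frequency [u] in the support of the bump is within [2 * w] of [y], hence at
    distance at least [|x - y| / 3] from [x]. *)
Lemma bernf_fast_far w y x : 0 < w -> 0 <= x <= 1 -> 3 * w <= `|x - y| ->
  bernf n (fun u => `|fast w y u|) x * (x - y) ^+ 2 <= 9 * w * (x / n%:R).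
Proof.
move=> w0 x01 xy; rewrite mulrC -bernfZ.
apply: (@le_trans _ _ (bernf n (fun u => 9 * w * (u - x) ^+ 2) x)); last first.
  by rewrite bernfZ ler_wpM2l ?bernf_var // mulr_ge0 // ltW.
apply: bernf_le => // u; have [uy|uy] := leP (2 * w) `|u - y|.
  by rewrite fast_out ?(ltW w0) // normr0 mulr0 mulr_ge0 ?sqr_ge0 // mulr_ge0 // ltW.
have h := ler_distD u x y; rewrite [`|x - u|]distrC in h.
rewrite -(real_normK (num_real (x - y))) -(real_normK (num_real (u - x))).
apply: (@le_trans _ _ ((3 * `|u - x|) ^+ 2 * w)); last by rewrite le_eqVlt; apply/orP; left; apply/eqP; ring.
apply: ler_pM; rewrite ?sqr_ge0 ?normr_ge0 ?fast_le ?(ltW w0) //.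
by rewrite ler_sqr ?nnegrE ?mulr_ge0 //; lra.
Qed.

Lemma bernf_fast_peak w y (b : bool) : 0 < w ->
  let x := y - (-1) ^+ b * w in 0 <= x <= 1 -> x / n%:R <= w ^+ 2 / 16 ->
  w / 2 <= (-1) ^+ b * bernf n (fast w y) x.
Proof.
move=> w0 x x01 xn; have w1 : 0 < w^-1 by rewrite invr_gt0.
rewrite -bernfZ.
(* The bump is 2-Lipschitz, so its signed value at [u] is at least [w - 2 * |u - x|], which
   dominates this parabola by AM-GM. The variance bound makes the quadratic term cost at most
   [w / 4]. *)
apply: (@le_trans _ _ (bernf n (fun u => 3 / 4 * w - (4 * w^-1) * (u - x) ^+ 2) x)).
  rewrite bernfB bernf_cst bernfZ.
  have := ler_wpM2l (ltW w1) (le_trans (bernf_var x01) xn).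
  rewrite (_ : w^-1 * (w ^+ 2 / 16) = w / 16); first lra.
  by field; rewrite gt_eqF.
apply: bernf_le => // u.
have peak := fast_peak y b (ltW w0).
have lip : w - 2 * `|u - x| <= (-1) ^+ b * fast w y u.
  rewrite -[w in leLHS]peak lerBlDr -lerBlDl -mulrBr (le_trans (ler_norm _)) //.
  by rewrite normrM normrX normrN1 expr1n mul1r distrC fast_lip.
apply: le_trans lip; rewrite -(real_normK (num_real (u - x))).
set z := `|u - x|; have : 0 <= w^-1 * (w / 2 - 2 * z) ^+ 2 by rewrite mulr_ge0 ?sqr_ge0 // ltW.
rewrite (_ : w^-1 * _ = w / 4 - 2 * z + 4 * w^-1 * z ^+ 2); first lra.
by field; rewrite gt_eqF.
Qed.

End BumpBernstein.

(** * Two-point lower bound by chi-square *)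

(* With [P] and [Q] the two product measures, [P (hi - G) + Q (G - lo)] is at
   least [(hi - lo) min(P, Q)], and [min(P, Q) >= 2 l P - l^2 (P + P^2 / Q)] for
   every [l]; the chi-square sum of [P^2 / Q] factorizes over the sample. *)
Lemma two_point (R : realType) n k (p q : 'I_k -> R) (G : n.-tuple 'I_k -> R)
    (lo hi X : R) : simplex R k p -> simplex R k q -> (forall j, 0 < q j) ->
  (\sum_j p j ^+ 2 / q j) ^+ n <= X -> lo <= hi -> (forall x, lo <= G x <= hi) ->
  iidE p G - iidE q G <= (hi - lo) * (1 - (1 + X)^-1).
Proof.
move=> /[dup] ps [p0 p1] /[dup] qs [q0' q1] q0 HX lohi Glh.
have X0 : 0 <= X.
  rewrite (le_trans _ HX) // exprn_ge0 // sumr_ge0 // => j _.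
  by rewrite divr_ge0 // sqr_ge0.
(* This [l] maximizes [2 * l - l ^+ 2 * (1 + X)], and the maximum is [l] itself. *)
set l := (1 + X)^-1; have l0 : 0 < l by rewrite invr_gt0; lra.
pose Y : n.-tuple 'I_k -> R := fun x =>
  (\prod_(i < n) p (tnth x i)) ^+ 2 / \prod_(i < n) q (tnth x i).
have YX : \sum_x Y x <= X.
  apply: le_trans HX; rewrite le_eqVlt; apply/orP; left; apply/eqP.
  have := iidE1 n (fun j => p j ^+ 2 / q j); rewrite /iidE => <-.
  by apply: eq_bigr => x _; rewrite mulr1 /Y -prodrXl -prodf_div.
have key : (hi - lo) * (\sum_x ((2 * l - l ^+ 2) * (\prod_(i < n) p (tnth x i)) -
    l ^+ 2 * Y x)) <= iidE p (fun x => hi - G x) + iidE q (fun x => G x - lo).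
  rewrite /iidE mulr_sumr -big_split; apply: ler_sum => x _ /=.
  rewrite /Y; set P := \prod_(i < n) p _; set Q := \prod_(i < n) q _.
  have P0 : 0 <= P by apply: prodr_ge0.
  have Q0 : 0 < Q by apply: prodr_gt0.
  have [Gl Gh] := andP (Glh x).
  set T := _ - _ * (P ^+ 2 / Q).
  have TP : T <= P.
    rewrite -subr_ge0.
    have -> : P - T = P * (1 - l) ^+ 2 + l ^+ 2 * (P ^+ 2 / Q) by rewrite /T; ring.
    by rewrite addr_ge0 // mulr_ge0 ?sqr_ge0 // divr_ge0 ?sqr_ge0 // ltW.
  have TQ : T <= Q.
    rewrite -subr_ge0.
    have -> : Q - T = (Q - l * P) ^+ 2 / Q + l ^+ 2 * P.
      by rewrite /T; field; rewrite gt_eqF.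
    by apply: addr_ge0; [apply: divr_ge0; rewrite ?sqr_ge0 ?(ltW Q0)
                        |apply: mulr_ge0; rewrite ?sqr_ge0].
  rewrite (_ : (hi - lo) * T = T * (hi - G x) + T * (G x - lo)); last by ring.
  by apply: lerD; apply: ler_wpM2r => //; rewrite subr_ge0.
have eqP : iidE p (fun x => hi - G x) = hi - iidE p G.
  by rewrite iidED iidE_cst // iidEN.
have eqQ : iidE q (fun x => G x - lo) = iidE q G - lo.
  by rewrite iidED iidE_cst.
move: key; rewrite eqP eqQ sumrB -!mulr_sumr.
have -> : \sum_(x : n.-tuple 'I_k) \prod_(i < n) p (tnth x i) = 1.
  transitivity (iidE p (fun _ : n.-tuple 'I_k => 1)); last exact: iidE_cst.
  by apply: eq_bigr => x _; rewrite mulr1.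
have lX : l ^+ 2 * (1 + X) = l by rewrite expr2 -mulrA mulVf ?mulr1 // gt_eqF //; lra.
have l2 : l <= (2 * l - l ^+ 2) * 1 - l ^+ 2 * \sum_x Y x.
  have := ler_wpM2l (sqr_ge0 l) YX; lra.
have := ler_wpM2l (_ : 0 <= hi - lo) l2; rewrite subr_ge0 => /(_ lohi).
lra.
Qed.

(** * The windows and the statistics attached to them *)

Section Blocks.
Variables (R : realType) (m n : nat).
Hypothesis m0 : (0 < m)%N.
Hypothesis mn : 256 * 256 * m%:R ^+ 3 <= n%:R :> R.

Local Notation M := (m%:R : R).
Local Notation N := (n%:R : R).

(* The scale of the fast bumps is [4] standard deviations of the empirical
   frequency of a symbol of probability [1 / m]. *)
Definition scale : R := 4 / Num.sqrt (N * M).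
(** The centers lie between [1 / (4 * M)] and [1 / (2 * M)] with spacing [4 * gap]. The plateaus
    reach [2 * gap] from their centers, so they are disjoint. *)
Definition gap : R := (16 * M ^+ 2)^-1.
Definition center (r : 'I_m) : R := (4 * M)^-1 + r%:R / (4 * M ^+ 2).
Local Notation w := scale.
Local Notation rho := gap.
Local Notation y := center.

Lemma block_n_gt0 : (0 < n)%N.
Proof.
rewrite -(ltr0n R); apply: lt_le_trans mn.
by apply: mulr_gt0; [apply: mulr_gt0; rewrite ltr0n|rewrite exprn_gt0 // ltr0n].
Qed.

Lemma M_ge1 : 1 <= M.
Proof. by rewrite ler1n. Qed.

Lemma M_gt0 : 0 < M.
Proof. by rewrite ltr0n. Qed.

Lemma N_gt0 : 0 < N.
Proof. by rewrite ltr0n block_n_gt0. Qed.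

Lemma scale_gt0 : 0 < w.
Proof. by rewrite divr_gt0 // sqrtr_gt0 mulr_gt0 ?N_gt0 ?M_gt0. Qed.

Lemma gap_gt0 : 0 < rho.
Proof. by rewrite invr_gt0 mulr_gt0 // exprn_gt0 // M_gt0. Qed.

Lemma scale_sqr : w ^+ 2 = 16 / (N * M).
Proof.
rewrite /scale exprMn exprVn sqr_sqrtr ?mulr_ge0 ?ler0n //.
by congr (_ / _); ring.
Qed.

Lemma scale_gap : w ^+ 2 / rho ^+ 2 = 4096 * (M ^+ 3 / N).
Proof.
rewrite scale_sqr /gap; field.
by rewrite (gt_eqF M_gt0) (gt_eqF N_gt0).
Qed.

(** By [mn], the squared ratio [4096 * M ^+ 3 / N] is at most [4096 / 256 ^+ 2 = 1 / 16]. This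
    separation of the two scales holds [m] to order n^(1/3). *)
Lemma scale_le_gap : w <= rho / 4.
Proof.
rewrite -ler_sqr ?nnegrE ?divr_ge0 ?(ltW scale_gt0) ?(ltW gap_gt0) //.
have -> : w ^+ 2 = (w ^+ 2 / rho ^+ 2) * rho ^+ 2.
  by rewrite divfK // expf_neq0 // gt_eqF // gap_gt0.
rewrite scale_gap exprMn mulrC ler_wpM2l ?sqr_ge0 //.
have : M ^+ 3 / N <= (256 * 256)^-1.
  rewrite ler_pdivrMr ?N_gt0 // mulrC ler_pdivlMr; first by rewrite mulrC; exact: mn.
  by apply: mulr_gt0; rewrite ltr0n.
lra.
Qed.

Lemma gap_M : rho * M <= 1 / 16.
Proof.
rewrite (_ : rho * M = (16 * M)^-1); last by rewrite /gap; field; rewrite gt_eqF // M_gt0.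
rewrite div1r lef_pV2 ?posrE ?mulr_gt0 ?M_gt0 //; have := M_ge1; lra.
Qed.

Lemma scale_M : w * M <= 1 / 64.
Proof.
have := ler_wpM2r (ltW M_gt0) scale_le_gap; have := gap_M; lra.
Qed.

Lemma invN_scale : N^-1 = w ^+ 2 * M / 16.
Proof. by rewrite scale_sqr; field; rewrite (gt_eqF M_gt0) (gt_eqF N_gt0). Qed.

Lemma invN_le : N^-1 <= w / 1024.
Proof.
have -> : N^-1 = w * (w * M) / 16 by rewrite invN_scale; ring.
have := ler_wpM2l (ltW scale_gt0) scale_M; lra.
Qed.

Lemma center_ge r : (4 * M)^-1 <= y r.
Proof. by rewrite /center lerDl divr_ge0 // mulr_ge0 // sqr_ge0. Qed.

Lemma center_le r : y r <= (2 * M)^-1.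
Proof.
have M0 := M_gt0.
have -> : (2 * M)^-1 = (4 * M)^-1 + M / (4 * M ^+ 2) by field; rewrite gt_eqF.
by rewrite lerD2l ler_wpM2r ?invr_ge0 ?mulr_ge0 ?sqr_ge0 // ler_nat ltnW.
Qed.

Lemma center_sep r r' : r != r' -> 4 * rho <= `|y r - y r'|.
Proof.
move=> rr'; have M0 := M_gt0.
rewrite /center opprD addrACA subrr add0r -mulrBl normrM.
rewrite (_ : 4 * rho = 1 * (4 * M ^+ 2)^-1); last by rewrite /gap; field; rewrite gt_eqF.
rewrite (@ger0_norm _ (_^-1)) ?invr_ge0 ?mulr_ge0 ?sqr_ge0 //.
rewrite ler_wpM2r ?invr_ge0 ?mulr_ge0 ?sqr_ge0 //.
have nat1 (i j : nat) : (i < j)%N -> 1 <= j%:R - i%:R :> R.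
  by move=> ij; rewrite -natrB ?(ltnW ij) // ler1n subn_gt0.
have [/nat1 h|/nat1 h|/val_inj rr'E] := ltngtP r r'.
- by rewrite distrC (le_trans h) // ler_norm.
- by rewrite (le_trans h) // ler_norm.
- by rewrite rr'E eqxx in rr'.
Qed.

Lemma plateau_disjoint u r r' :
  plateau rho (y r) u != 0 -> plateau rho (y r') u != 0 -> r = r'.
Proof.
have near s : plateau rho (y s) u != 0 -> `|u - y s| < 2 * rho.
  by move=> ps; rewrite ltNge; apply: contra ps => /(plateau_out gap_gt0) ->.
move=> /near hr /near hr'; apply/eqP; apply/negPn/negP => /center_sep.
have := ler_distD u (y r) (y r'); rewrite [`|y r - u|]distrC; lra.
Qed.

Lemma fast_plateau u r : fast w (y r) u != 0 -> plateau rho (y r) u = 1.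
Proof.
move=> fr; apply: plateau_in gap_gt0 _; rewrite leNgt; apply: contra fr => h.
rewrite fast_out ?(ltW scale_gt0) //; have := scale_le_gap; have := gap_gt0; lra.
Qed.

Lemma fast_disjoint u r r' :
  fast w (y r) u != 0 -> fast w (y r') u != 0 -> r = r'.
Proof.
by move=> /fast_plateau hr /fast_plateau hr'; apply: (@plateau_disjoint u);
  rewrite ?hr ?hr' oner_eq0.
Qed.

(** For a symbol of probability [x], [eslow r x] is a soft indicator of membership in window [r],
    [cfast r x] a signed reading of its position there, and [dfast r x] a bound on the size of that
    reading. *)
Definition cfast r := bernf n (fast w (y r)).
Definition dfast r := bernf n (fun u => `|fast w (y r) u|).
Definition eslow r := bernf n (plateau rho (y r)).

Section Pointwise.
Variable x : R.
Hypothesis x01 : 0 <= x <= 1.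

Lemma cfast_le_dfast r : `|cfast r x| <= dfast r x.
Proof. exact: bernf_norm. Qed.

Lemma dfast_ge0 r : 0 <= dfast r x.
Proof. by apply: bernf_ge0 => // u; exact: normr_ge0. Qed.

Lemma eslow_ge0 r : 0 <= eslow r x.
Proof. by apply: bernf_ge0 => // u; exact: plateau_ge0. Qed.

Lemma eslow_le1 r : eslow r x <= 1.
Proof.
rewrite -(bernf_cst n 1 x); apply: bernf_le => // u; exact: plateau_le1.
Qed.

Lemma dfast_le_eslow r : dfast r x <= w * eslow r x.
Proof.
apply: bernf_fast_le => //; [exact: scale_gt0|exact: gap_gt0|].
have := scale_le_gap; have := gap_gt0; lra.
Qed.

Lemma dfast_le r : dfast r x <= w.
Proof.
rewrite (le_trans (dfast_le_eslow _)) // -[leRHS]mulr1.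
by rewrite ler_wpM2l ?eslow_le1 // ltW // scale_gt0.
Qed.

Lemma sum_eslow_le1 : \sum_r eslow r x <= 1.
Proof.
rewrite -bernf_sum -[leRHS](bernf_cst n 1 x); apply: bernf_le => // u.
apply: sum_disjoint_le => // [r|r r']; first exact: plateau_le1.
exact: plateau_disjoint.
Qed.

Lemma sum_dfast_le : \sum_r dfast r x <= w.
Proof.
apply: (@le_trans _ _ (\sum_r w * eslow r x)).
  by apply: ler_sum => r _; exact: dfast_le_eslow.
by rewrite -mulr_sumr -[leRHS]mulr1 ler_wpM2l ?sum_eslow_le1 // ltW // scale_gt0.
Qed.

(* The product of the two expectations is an expectation over two independent
   frequencies [u] and [u'], which must be at distance at least [gap / 2]. *)
Lemma sum_dfast_eslow :
  \sum_r dfast r x * (1 - eslow r x) <= w * (8 * x / (N * rho ^+ 2)).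
Proof.
have w0 := ltW scale_gt0; have r0 := gap_gt0; have N0 := N_gt0.
have n0 := block_n_gt0.
have -> : \sum_r dfast r x * (1 - eslow r x) =
    bernf n (fun u => bernf n (fun u' => \sum_r
      `|fast w (y r) u| * (1 - plateau rho (y r) u')) x) x.
  transitivity (bernf n (fun u => \sum_r (1 - eslow r x) * `|fast w (y r) u|) x).
    by rewrite bernf_sum; apply: eq_bigr => r _; rewrite bernfZ mulrC.
  congr (bernf n _ x); apply/funext => u; rewrite bernf_sum.
  by apply: eq_bigr => r _; rewrite bernfZ bernfB bernf_cst mulrC.
have K0 : 0 <= 4 * w / rho ^+ 2 by rewrite divr_ge0 ?sqr_ge0 // mulr_ge0.
have step u u' : \sum_r `|fast w (y r) u| * (1 - plateau rho (y r) u') <=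
    4 * w / rho ^+ 2 * (u' - u) ^+ 2.
  apply: sum_disjoint_le => [|r|r r' h h'].
  - by rewrite mulr_ge0 // sqr_ge0.
  - have [->|fr] := eqVneq (fast w (y r) u) 0.
      by rewrite normr0 mul0r mulr_ge0 // sqr_ge0.
    have [->|pr] := eqVneq (plateau rho (y r) u') 1.
      by rewrite subrr mulr0 mulr_ge0 // sqr_ge0.
    have hu : `|u - y r| < 2 * w.
      by rewrite ltNge; apply: contra fr => h; rewrite fast_out.
    have hu' : rho < `|u' - y r|.
      by rewrite ltNge; apply: contra pr => h; rewrite plateau_in.
    have huu : rho / 2 <= `|u' - u|.
      have := ler_distD u u' (y r); have := scale_le_gap; lra.
    apply: (@le_trans _ _ (w * 1)).
      by apply: ler_pM; rewrite ?fast_le ?subr_ge0 ?plateau_le1 ?gerBl ?plateau_ge0.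
    rewrite (_ : 4 * w / _ * _ = w * ((u' - u) ^+ 2 / (rho / 2) ^+ 2)); last first.
      by field; rewrite gt_eqF.
    rewrite ler_wpM2l // ler_pdivlMr ?exprn_gt0 ?divr_gt0 // mul1r.
    by rewrite -(real_normK (num_real (u' - u))) ler_sqr ?nnegrE ?divr_ge0 // ltW.
  - apply: (@fast_disjoint u).
      by apply: contraNneq h => ->; rewrite normr0 mul0r.
    by apply: contraNneq h' => ->; rewrite normr0 mul0r.
apply: (@le_trans _ _ (bernf n (fun u => 4 * w / rho ^+ 2 *
    ((u - x) ^+ 2 + x / N)) x)).
  apply: bernf_le => // u.
  apply: (le_trans (bernf_le n x01 (step u))).
  rewrite bernfZ ler_wpM2l // bernf_sqr // -[(x - u) ^+ 2]sqrrN opprB lerD2l.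
  apply: ler_wpM2r; first by rewrite invr_ge0 ltW.
  case/andP: x01 => *; nra.
rewrite bernfZ bernfD bernf_cst.
apply: (@le_trans _ _ (4 * w / rho ^+ 2 * (x / N + x / N))).
  by rewrite ler_wpM2l // lerD2r bernf_var.
rewrite le_eqVlt; apply/orP; left; apply/eqP; field.
by rewrite !gt_eqF.
Qed.

Lemma eslow_near r : `|x - y r| < 3 * w -> x <= M^-1 ->
  1 - eslow r x <= 10 * (w ^+ 2 / rho ^+ 2).
Proof.
move=> xy xM; have N0 := N_gt0; have M0 := M_gt0.
rewrite (le_trans (bernf_plateau _ _ gap_gt0 _)) ?block_n_gt0 //.
rewrite mulrA ler_wpM2r ?invr_ge0 ?sqr_ge0 //.
have h1 : (x - y r) ^+ 2 <= (3 * w) ^+ 2.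
  rewrite -(real_normK (num_real (x - y r))) ler_sqr ?nnegrE ?(ltW xy) //.
  by rewrite mulr_ge0 // ltW // scale_gt0.
have h2 : x / N <= M^-1 / N by rewrite ler_wpM2r // invr_ge0 ltW.
have h3 : M^-1 / N = w ^+ 2 / 16 by rewrite scale_sqr; field; rewrite !gt_eqF.
have := sqr_ge0 w; rewrite h3 in h2; move: h1; rewrite exprMn; lra.
Qed.

End Pointwise.

(** * Extremal positions and the [2 ^ m] hypotheses *)

Lemma peak_exists r (b : bool) : exists x : R, 0 <= x <= 1 /\
  forall t, 0 <= t <= 1 -> (-1) ^+ b * cfast r t <= (-1) ^+ b * cfast r x.
Proof.
have [|x x01 xmax] := @EVT_max R (fun x => (-1) ^+ b * cfast r x) 0 1 ler01.
  apply: continuous_subspaceT => x; apply: cvgM; first exact: cvg_cst.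
  exact: bern_continuous.
exists x; split; first by move: x01; rewrite in_itv.
by move=> t t01; apply: xmax; rewrite in_itv.
Qed.

(** The exact maximizer is taken instead of the natural candidate [center r - (-1) ^+ b * scale], so
    that by [le_height] no symbol of any distribution can contribute more than the one planted by
    the hypothesis. *)
Definition peak r b : R := sval (cid (peak_exists r b)).
Definition height r (b : bool) : R := (-1) ^+ b * cfast r (peak r b).

Lemma peak01 r b : 0 <= peak r b <= 1.
Proof. by rewrite /peak; case: cid => x []. Qed.

Lemma le_height r (b : bool) x : 0 <= x <= 1 -> (-1) ^+ b * cfast r x <= height r b.
Proof. by rewrite /height /peak; case: cid => z [_ h] /=; exact: h. Qed.

Lemma inv2M_le : (2 * M)^-1 + 3 * w <= M^-1.
Proof.
have -> : (2 * M)^-1 = M^-1 / 2 by field; rewrite gt_eqF // M_gt0.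
have -> : w = w * M * M^-1 by rewrite mulfK // gt_eqF // M_gt0.
have iM : 0 <= M^-1 by rewrite invr_ge0 ltW // M_gt0.
have := ler_wpM2r iM scale_M; lra.
Qed.

Lemma le_inv4M : (8 * M)^-1 + 3 * w <= (4 * M)^-1.
Proof.
have -> : (8 * M)^-1 = M^-1 / 8 by field; rewrite gt_eqF // M_gt0.
have -> : (4 * M)^-1 = M^-1 / 4 by field; rewrite gt_eqF // M_gt0.
have -> : w = w * M * M^-1 by rewrite mulfK // gt_eqF // M_gt0.
have iM : 0 <= M^-1 by rewrite invr_ge0 ltW // M_gt0.
have := ler_wpM2r iM scale_M; lra.
Qed.

Lemma invM_le1 : M^-1 <= 1.
Proof. by rewrite invf_le1 ?M_gt0 // M_ge1. Qed.

Lemma near_center r x : `|x - y r| <= 3 * w -> (8 * M)^-1 <= x <= M^-1.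
Proof.
have := center_le r; have := center_ge r; have := inv2M_le; have := le_inv4M.
move=> h1 h2 h3 h4; rewrite ler_norml => /andP[h5 h6].
by apply/andP; split; lra.
Qed.

Lemma height_ge r b : w / 2 <= height r b.
Proof.
have w0 := scale_gt0.
have h : `|y r - (-1) ^+ b * w - y r| <= 3 * w.
  rewrite addrAC subrr add0r normrN normrM normrX normrN1 expr1n mul1r ger0_norm //; lra.
have /andP[x1 x2] := near_center h.
have M0 := M_gt0; have N0 := N_gt0.
have x0 : 0 <= (8 * M)^-1 by rewrite invr_ge0 mulr_ge0 // ltW.
have x01 : 0 <= y r - (-1) ^+ b * w <= 1.
  by rewrite (le_trans x0 x1) (le_trans x2 invM_le1).
apply: le_trans (le_height r b x01); apply: bernf_fast_peak => //.
  exact: block_n_gt0.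
rewrite (_ : w ^+ 2 / 16 = M^-1 / N); last by rewrite scale_sqr; field; rewrite !gt_eqF.
by rewrite ler_wpM2r // invr_ge0 ltW.
Qed.

Lemma height_ge0 r b : 0 <= height r b.
Proof. by rewrite (le_trans _ (height_ge r b)) // divr_ge0 // ltW // scale_gt0. Qed.

Lemma height_le_dfast r b : height r b <= dfast r (peak r b).
Proof.
rewrite (le_trans (ler_norm _)) // normrM normrX normrN1 expr1n mul1r.
exact/cfast_le_dfast/peak01.
Qed.

Lemma height_le r b : height r b <= w.
Proof. by rewrite (le_trans (height_le_dfast r b)) // dfast_le // peak01. Qed.

(** At distance [3 * w] or more from the center, [bernf_fast_far] makes the smoothed bump too small
    to reach the height [w / 2]. *)
Lemma peak_near r b : `|peak r b - y r| < 3 * w.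
Proof.
rewrite ltNge; apply/negP => far; have w0 := scale_gt0; have N0 := N_gt0.
have M0 := M_gt0.
have := bernf_fast_far block_n_gt0 w0 (peak01 r b) far.
rewrite -[bernf _ _ _]/(dfast r (peak r b)).
have := le_trans (height_ge r b) (height_le_dfast r b).
move: (dfast r _) => d dw.
set D := `|peak r b - y r| in far *.
have -> : (peak r b - y r) ^+ 2 = D ^+ 2 by rewrite real_normK // num_real.
(* The maximizer could a priori be anywhere in [[0, 1]], so the variance bound must grow with [D];
   it does so only linearly and loses to [D ^+ 2]. *)
have xD : peak r b <= (2 * M)^-1 + D.
  have := ler_norm (peak r b - y r); rewrite -/D; have := center_le r; lra.
have xN : peak r b / N <= w ^+ 2 / 32 + D * (w / 1024).
  rewrite (le_trans (ler_wpM2r _ xD)) ?invr_ge0 ?(ltW N0) // mulrDl lerD //.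
    rewrite le_eqVlt; apply/orP; left; apply/eqP.
    by rewrite scale_sqr; field; rewrite !gt_eqF.
  by rewrite ler_wpM2l ?invN_le // normr_ge0.
move=> h.
have h1 : w / 2 * D ^+ 2 <= 9 * w * (w ^+ 2 / 32 + D * (w / 1024)).
  apply: le_trans (ler_wpM2r (sqr_ge0 D) dw) (le_trans h _).
  by rewrite ler_wpM2l // mulr_ge0 // ltW.
have h2 : D ^+ 2 / 2 <= 9 * (w ^+ 2 / 32 + D * (w / 1024)).
  rewrite -(ler_pM2l w0); apply: le_trans (le_trans _ h1) _; lra.
have D0 : 0 <= D - 3 * w by rewrite subr_ge0.
have := mulr_ge0 D0 D0; have := mulr_ge0 D0 (ltW w0); have := mulr_gt0 w0 w0.
rewrite !expr2 in h2; nra.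
Qed.

Lemma peak_range r b : (8 * M)^-1 <= peak r b <= M^-1.
Proof. exact/near_center/ltW/peak_near. Qed.

Lemma peak_le r b : peak r b <= (2 * M)^-1 + 3 * w.
Proof.
have := ler_norm (peak r b - y r); have := peak_near r b; have := center_le r; lra.
Qed.

Lemma eslow_peak r b : 1 - eslow r (peak r b) <= 10 * (w ^+ 2 / rho ^+ 2).
Proof.
by apply: eslow_near; rewrite ?peak01 ?peak_near //; case/andP: (peak_range r b).
Qed.

(** Symbol [lift ord0 r] encodes [v r] by its position in window [r]; symbol [ord0] absorbs the
    remaining mass, at least [1 / 4] by [hypo0_ge]. *)
Definition hypo (v : {ffun 'I_m -> bool}) (j : 'I_m.+1) : R :=
  if unlift ord0 j is Some r then peak r (v r) else 1 - \sum_r peak r (v r).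

Lemma hypo0 v : hypo v ord0 = 1 - \sum_r peak r (v r).
Proof. by rewrite /hypo unlift_none. Qed.

Lemma hypo_lift v r : hypo v (lift ord0 r) = peak r (v r).
Proof. by rewrite /hypo liftK. Qed.

Lemma hypo0_ge v : 1 / 4 <= hypo v ord0.
Proof.
have : \sum_r peak r (v r) <= \sum_(r < m) ((2 * M)^-1 + 3 * w).
  by apply: ler_sum => r _; exact: peak_le.
rewrite sumr_const card_ord -[leRHS]mulr_natr mulrDl -mulrA.
rewrite (_ : (2 * M)^-1 * M = 1 / 2); last by field; rewrite gt_eqF // M_gt0.
rewrite hypo0; have := scale_M; lra.
Qed.

Lemma hypo_ge v j : (8 * M)^-1 <= hypo v j.
Proof.
have [r ->|->] := unliftP ord0 j.
  by rewrite hypo_lift; case/andP: (peak_range r (v r)).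
rewrite (le_trans _ (hypo0_ge v)) // div1r lef_pV2 ?posrE ?mulr_gt0 ?M_gt0 //.
have := M_ge1; lra.
Qed.

Lemma hypo_gt0 v j : 0 < hypo v j.
Proof.
by rewrite (lt_le_trans _ (hypo_ge v j)) // invr_gt0 mulr_gt0 // M_gt0.
Qed.

Lemma hypo_simplex v : simplex R m.+1 (hypo v).
Proof.
split=> [j|]; first exact/ltW/hypo_gt0.
rewrite big_ord_recl (eq_bigr _ (fun r _ => hypo_lift v r)) hypo0.
by rewrite subrK.
Qed.

Definition flip (r : 'I_m) (v : {ffun 'I_m -> bool}) : {ffun 'I_m -> bool} :=
  [ffun s => if s == r then ~~ v s else v s].

Lemma flipK r : involutive (flip r).
Proof. by move=> v; apply/ffunP => s; rewrite !ffunE; case: eqP => // _; rewrite negbK. Qed.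

(** A flip moves the mass of one symbol by at most [6 * w], and that of [ord0] by the opposite
    amount. With all masses at least [1 / (8 * M)], each of the two terms is at most
    [36 * w ^+ 2 * 8 * M = 4608 / N]. *)
Lemma chi2_flip v r :
  (\sum_j hypo v j ^+ 2 / hypo (flip r v) j) ^+ n <= expR 9216.
Proof.
have N0 := N_gt0; have M0 := M_gt0.
pose p := hypo v; pose q := hypo (flip r v).
have pq j : p j ^+ 2 / q j = 2 * p j - q j + (p j - q j) ^+ 2 / q j.
  by field; rewrite gt_eqF // hypo_gt0.
have -> : \sum_j p j ^+ 2 / q j = 1 + \sum_j (p j - q j) ^+ 2 / q j.
  under eq_bigr do rewrite pq.
  rewrite big_split sumrB -mulr_sumr /=.
  have [_ ->] := hypo_simplex v; have [_ ->] := hypo_simplex (flip r v).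
  by congr (_ + _); ring.
have other s : s != r -> peak s (v s) = peak s (flip r v s).
  by move=> /negPf sr; rewrite ffunE sr.
have dl : p (lift ord0 r) - q (lift ord0 r) = peak r (v r) - peak r (flip r v r).
  by rewrite /p /q !hypo_lift.
have d0 : p ord0 - q ord0 = - (peak r (v r) - peak r (flip r v r)).
  rewrite /p /q !hypo0 (bigD1 r) //= [in X in _ - X](bigD1 r) //=.
  by rewrite (eq_bigr _ other); ring.
have d6 : (peak r (v r) - peak r (flip r v r)) ^+ 2 <= (6 * w) ^+ 2.
  rewrite -(real_normK (num_real (_ - _))) ler_sqr ?nnegrE ?mulr_ge0 ?(ltW scale_gt0) //.
  have := ler_distD (y r) (peak r (v r)) (peak r (flip r v r)).
  have := peak_near r (v r); have := peak_near r (flip r v r).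
  by rewrite [`|y r - _|]distrC; lra.
have term j : (p j - q j) ^+ 2 <= (6 * w) ^+ 2 ->
    (p j - q j) ^+ 2 / q j <= (6 * w) ^+ 2 * (8 * M).
  move=> h; apply: ler_pM => //; rewrite ?sqr_ge0 ?invr_ge0 ?(ltW (hypo_gt0 _ _)) //.
  by rewrite -[leRHS]invrK lef_pV2 ?posrE ?hypo_gt0 ?hypo_ge // invr_gt0 mulr_gt0.
have sum_le : \sum_j (p j - q j) ^+ 2 / q j <= 9216 / N.
  rewrite big_ord_recl (bigD1 r) //= big1 ?addr0; last first.
    by move=> s sr; rewrite /p /q !hypo_lift -other // subrr expr0n mul0r.
  apply: (@le_trans _ _ ((6 * w) ^+ 2 * (8 * M) + (6 * w) ^+ 2 * (8 * M))).
    by apply: lerD; apply: term; rewrite ?d0 ?dl ?sqrrN.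
  rewrite exprMn scale_sqr le_eqVlt; apply/orP; left; apply/eqP; field.
  by rewrite !gt_eqF.
have e1 : 1 + \sum_j (p j - q j) ^+ 2 / q j <= expR (9216 / N).
  by rewrite (le_trans _ (expR_ge1Dx _)) // lerD2l.
have -> : expR 9216 = expR (9216 / N) ^+ n.
  by rewrite -expRM_natl mulrC divfK // gt_eqF.
apply: lerXn2r => //; rewrite nnegrE ?expR_ge0 // addr_ge0 // sumr_ge0 // => j _.
by rewrite divr_ge0 ?sqr_ge0 // ltW // hypo_gt0.
Qed.

(** * Soft counts and signed sums over the windows *)

Lemma simplex01 k (q : 'I_k -> R) j : simplex R k q -> 0 <= q j <= 1.
Proof.
move=> [q0 q1]; rewrite q0 /= -q1 (bigD1 j) //= lerDl.
exact: sumr_ge0.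
Qed.

Definition Asum r (q : 'I_m.+1 -> R) := \sum_j cfast r (q j).
Definition Ssum r (q : 'I_m.+1 -> R) := \sum_j eslow r (q j).

Local Notation eta := (10 * (w ^+ 2 / rho ^+ 2)).

Lemma sum_Ssum_le q : simplex R m.+1 q -> \sum_r Ssum r q <= M + 1.
Proof.
move=> qs; rewrite exchange_big /=.
apply: (@le_trans _ _ (\sum_(j < m.+1) 1)).
  by apply: ler_sum => j _; apply/sum_eslow_le1/simplex01.
by rewrite sumr_const card_ord natr1.
Qed.

Lemma Ssum_ge0 r q : simplex R m.+1 q -> 0 <= Ssum r q.
Proof. by move=> qs; apply: sumr_ge0 => j _; apply/eslow_ge0/simplex01. Qed.

Lemma Ssum_hypo_ge (v : {ffun 'I_m -> bool}) r : eslow r (peak r (v r)) <= Ssum r (hypo v).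
Proof.
rewrite /Ssum (bigD1 (lift ord0 r)) //= hypo_lift lerDl.
by apply: sumr_ge0 => j _; apply/eslow_ge0/simplex01/hypo_simplex.
Qed.

(** A budget argument: the [m + 1] symbols have total soft count at most [M + 1], and the planted
    ones already use [M * (1 - eta)]. *)
Lemma sum_spill (v : {ffun 'I_m -> bool}) : \sum_r (Ssum r (hypo v) - eslow r (peak r (v r))) <= 1 + M * eta.
Proof.
rewrite sumrB; have := sum_Ssum_le (hypo_simplex v).
have : \sum_(r < m) (1 - eta) <= \sum_r eslow r (peak r (v r)).
  by apply: ler_sum => r _; have := eslow_peak r (v r); lra.
rewrite sumr_const card_ord -[X in X <= _]mulr_natl; lra.
Qed.

Lemma Ssum_hypo v : \sum_r `|Ssum r (hypo v) - 1| <= 1 + 2 * (M * eta).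
Proof.
apply: (@le_trans _ _ (\sum_r (Ssum r (hypo v) - eslow r (peak r (v r)) + eta))).
  apply: ler_sum => r _; have := Ssum_hypo_ge v r; have := eslow_peak r (v r).
  have := eslow_le1 (peak01 r (v r)) r.
  by rewrite ler_norml => *; apply/andP; split; lra.
rewrite big_split /= sumr_const card_ord -[X in _ + X]mulr_natl.
by have := sum_spill v; lra.
Qed.

(** The planted symbol contributes exactly [height r (v r)]; any other symbol subtracts at most [w]
    times its soft weight in the window, and [sum_spill] bounds the total. *)
Lemma Asum_hypo (v : {ffun 'I_m -> bool}) :
  \sum_r height r (v r) - w * (1 + M * eta) <=
  \sum_r (-1) ^+ v r * Asum r (hypo v).
Proof.
have w0 := ltW scale_gt0.
apply: (@le_trans _ _ (\sum_r (height r (v r) -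
    w * (Ssum r (hypo v) - eslow r (peak r (v r)))))).
  by rewrite sumrB -mulr_sumr lerD2l lerN2 ler_wpM2l // sum_spill.
apply: ler_sum => r _.
have -> : (-1) ^+ v r * Asum r (hypo v) = height r (v r) +
    (-1) ^+ v r * \sum_(j | j != lift ord0 r) cfast r (hypo v j).
  by rewrite /Asum (bigD1 (lift ord0 r)) //= hypo_lift mulrDr.
have -> : Ssum r (hypo v) - eslow r (peak r (v r)) =
    \sum_(j | j != lift ord0 r) eslow r (hypo v j).
  by rewrite /Ssum (bigD1 (lift ord0 r)) //= hypo_lift [X in X - _]addrC addrK.
rewrite lerD2l -mulrN -sumrN !mulr_sumr ler_sum // => j _.
have x01 := simplex01 j (hypo_simplex v).
have := dfast_le_eslow x01 r; have := cfast_le_dfast x01 r.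
rewrite mulrN -normrN => h1 h2.
have : `|(-1) ^+ v r * cfast r (hypo v j)| <= w * eslow r (hypo v j).
  by rewrite normrM normrX normrN1 expr1n mul1r -normrN (le_trans h1).
by rewrite ler_norml => /andP[].
Qed.

(** [two_point] requires a bounded statistic; these bounds are the extreme contributions of a single
    symbol. *)
Definition clip r (a : R) : R := Num.min (height r false) (Num.max (- height r true) a).

Lemma clip_range r a : - height r true <= clip r a <= height r false.
Proof.
rewrite /clip le_min ge_min lexx /= andbT le_max lexx /= andbT.
by have := height_ge0 r false; have := height_ge0 r true; lra.
Qed.

Lemma clip_dist r a K : 0 <= K -> a - height r false <= K ->
  - a - height r true <= K -> `|a - clip r a| <= K.
Proof.
move=> K0 h1 h2; have h0 := height_ge0 r false; have h0' := height_ge0 r true.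
rewrite /clip ler_norml; case: (lerP (- height r true) a) => ha.
  by case: (lerP (height r false) a) => ?; apply/andP; split; lra.
by case: (lerP (height r false) (- height r true)) => ?; apply/andP; split; lra.
Qed.

(** Split each contribution by the weights [eslow] and [1 - eslow]. The first part is at most
    [height * Ssum], exceeding the clipping level only if the soft count exceeds 1; the second is
    controlled by [sum_dfast_eslow], whose bound is linear in [q j] and sums to a constant. *)
Lemma sum_clip q : simplex R m.+1 q ->
  \sum_r `|Asum r q - clip r (Asum r q)| <=
  w * \sum_r `|Ssum r q - 1| + w * (8 / (N * rho ^+ 2)).
Proof.
move=> qs; have w0 := ltW scale_gt0.
pose D r := \sum_j dfast r (q j) * (1 - eslow r (q j)).
have D0 r : 0 <= D r.
  apply: sumr_ge0 => j _; have x01 := simplex01 j qs.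
  by rewrite mulr_ge0 ?dfast_ge0 // subr_ge0 eslow_le1.
have one r (b : bool) : (-1) ^+ b * Asum r q <= height r b * Ssum r q + D r.
  rewrite /Asum /Ssum /D !mulr_sumr -big_split ler_sum // => j _ /=.
  have x01 := simplex01 j qs; set x := q j in x01 *.
  rewrite (_ : _ * cfast r x = (-1) ^+ b * cfast r x * eslow r x +
    (-1) ^+ b * cfast r x * (1 - eslow r x)); last by ring.
  apply: lerD; first by rewrite ler_wpM2r ?eslow_ge0 ?le_height.
  rewrite ler_wpM2r ?subr_ge0 ?eslow_le1 // (le_trans (ler_norm _)) //.
  by rewrite normrM normrX normrN1 expr1n mul1r cfast_le_dfast.
have hS r (b : bool) : height r b * (Ssum r q - 1) <= w * `|Ssum r q - 1|.
  rewrite (le_trans (ler_norm _)) // normrM (ger0_norm (height_ge0 _ _)).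
  by rewrite ler_wpM2r ?height_le.
apply: (@le_trans _ _ (\sum_r (w * `|Ssum r q - 1| + D r))).
  apply: ler_sum => r _; apply: clip_dist.
  - by rewrite addr_ge0 // mulr_ge0.
  - by have := one r false; have := hS r false; rewrite expr0 mul1r; lra.
  - by have := one r true; have := hS r true; rewrite expr1 mulN1r; lra.
rewrite big_split /= -mulr_sumr lerD2l /D exchange_big /=.
apply: (@le_trans _ _ (\sum_j w * (8 * q j / (N * rho ^+ 2)))).
  by apply: ler_sum => j _; apply/sum_dfast_eslow/simplex01.
have [_ q1] := qs.
rewrite -mulr_sumr -mulr_suml -mulr_sumr q1 mulr1 //.
Qed.

(** * Assouad's argument over the sign patterns *)

Section Assouad.
Variable q : n.-tuple 'I_m.+1 -> 'I_m.+1 -> R.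
Hypothesis qs : forall x, simplex R m.+1 (q x).

(** The hypotheses say that [q] has nearly correct window counts and loses little of the signed sum.
    They bound the total loss of the clipped statistics from above, while pairing each pattern with
    its flips bounds the average loss from below. *)
Lemma assouad (theta delta : R) :
  (forall v, iidE (hypo v) (fun x => \sum_r `|Ssum r (q x) - Ssum r (hypo v)|)
     <= theta * M) ->
  (forall v, iidE (hypo v) (fun x => \sum_r (-1) ^+ v r *
     (Asum r (hypo v) - Asum r (q x))) <= delta * w * M) ->
  M * (1 + expR 9216)^-1 / 2 <= M * (delta + theta + 3 * eta) + 2 + 8 / (N * rho ^+ 2).
Proof.
move=> Hs Hf; have w0 := scale_gt0.
have [tau tauE] : exists tau, tau = (1 + expR 9216)^-1 :> R by exists (1 + expR 9216)^-1.
rewrite -tauE; have tau0 : 0 < tau by rewrite tauE invr_gt0; exact: addr_gt0 ltr01 (expR_gt0 _).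
set W := M * _ + 2 + _.
(* The expected shortfall of the clipped statistic from its best value for the sign [v r]. *)
pose phi (v : {ffun 'I_m -> bool}) r := height r (v r) -
  (-1) ^+ v r * iidE (hypo v) (fun x => clip r (Asum r (q x))).
have phi_le v : \sum_r phi v r <= w * W.
  have ps := hypo_simplex v; have p0 := ps.1.
  have step x : \sum_r (-1) ^+ v r * (Asum r (hypo v) - clip r (Asum r (q x))) <=
    \sum_r (-1) ^+ v r * (Asum r (hypo v) - Asum r (q x)) +
    (w * \sum_r `|Ssum r (q x) - Ssum r (hypo v)| +
      (w * (1 + 2 * (M * eta)) + w * (8 / (N * rho ^+ 2)))).
    have hS : \sum_r `|Ssum r (q x) - 1| <=
        \sum_r `|Ssum r (q x) - Ssum r (hypo v)| + (1 + 2 * (M * eta)).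
      rewrite (le_trans _ (lerD (lexx _) (Ssum_hypo v))) // -big_split.
      by apply: ler_sum => r _; exact: ler_distD.
    have hc : \sum_r (-1) ^+ v r * (Asum r (q x) - clip r (Asum r (q x))) <=
        \sum_r `|Asum r (q x) - clip r (Asum r (q x))|.
      apply: ler_sum => r _; rewrite (le_trans (ler_norm _)) //.
      by rewrite normrM normrX normrN1 expr1n mul1r.
    have -> : \sum_r (-1) ^+ v r * (Asum r (hypo v) - clip r (Asum r (q x))) =
        \sum_r (-1) ^+ v r * (Asum r (hypo v) - Asum r (q x)) +
        \sum_r (-1) ^+ v r * (Asum r (q x) - clip r (Asum r (q x))).
      by rewrite -big_split; apply: eq_bigr => r _ /=; ring.
    rewrite lerD2l (le_trans hc) // (le_trans (sum_clip (qs x))) //.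
    by rewrite addrA lerD2r -mulrDr ler_wpM2l // ltW.
  have := iidE_le p0 step; rewrite iidED iidED iidEZ iidE_cst // => h.
  have {}h := le_trans h (lerD (Hf v) (lerD (ler_wpM2l (ltW w0) (Hs v)) (lexx _))).
  have hp := Asum_hypo v.
  have eP : iidE (hypo v) (fun x => \sum_r (-1) ^+ v r *
      (Asum r (hypo v) - clip r (Asum r (q x)))) =
    \sum_r (-1) ^+ v r * Asum r (hypo v) -
    \sum_r (-1) ^+ v r * iidE (hypo v) (fun x => clip r (Asum r (q x))).
    rewrite iidE_sum -sumrB; apply: eq_bigr => r _.
    by rewrite iidEZ iidED iidE_cst // iidEN mulrBr.
  rewrite eP in h; rewrite /phi sumrB /W; move: h hp.
  set a := \sum_r _; set b := \sum_r _; set c := \sum_r _.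
  set e := eta; set g := 8 / _ => h hp.
  have -> : w * (M * (delta + theta + 3 * e) + 2 + g) = delta * w * M +
    (w * (theta * M) + (w * (1 + 2 * (M * e)) + w * g)) + w * (1 + M * e) by ring.
  by lra.
(* The clipping interval has length at least [w]. By [two_point] the two means are separated by at
   most a fraction [1 - tau] of that length, so the two shortfalls share the rest. *)
have phi_flip v r : w * tau <= phi v r + phi (flip r v) r.
  have ps u := hypo_simplex u.
  have tp u := two_point (ps u) (ps (flip r u)) (hypo_gt0 (flip r u))
    (chi2_flip u r) (_ : - height r true <= height r false)
    (fun x => clip_range r (Asum r (q x))).
  have h0 : - height r true <= height r false.
    by rewrite (le_trans _ (height_ge0 r false)) // oppr_le0 height_ge0.
  have t1 := tp h0 v; have := tp h0 (flip r v); rewrite flipK => t2.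
  rewrite -tauE in t1 t2.
  have hw : w * tau <= (height r false + height r true) * tau.
    rewrite ler_wpM2r ?(ltW tau0) //.
    by have := lerD (height_ge r false) (height_ge r true); rewrite -splitr.
  apply: (le_trans hw); rewrite /phi ffunE eqxx.
  clear - t1 t2.
  by case: (v r); rewrite /= ?expr1 ?expr0; lra.
have sum_phi r : #|{: {ffun 'I_m -> bool}}|%:R * (w * tau) / 2 <= \sum_v phi v r.
  have e2 : \sum_v phi v r + \sum_v phi v r = \sum_v (phi v r + phi (flip r v) r).
    rewrite [RHS]big_split; congr (_ + _).
    exact: (reindex_inj (can_inj (flipK r))).
  have : \sum_(v : {ffun 'I_m -> bool}) (w * tau) <= \sum_v phi v r + \sum_v phi v r.
    by rewrite e2; apply: ler_sum => v _; exact: phi_flip.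
  by rewrite sumr_const -[X in X <= _]mulr_natl; lra.
have V0 : 0 < #|{: {ffun 'I_m -> bool}}|%:R :> R.
  by rewrite ltr0n; apply/card_gt0P; exists [ffun=> false].
set V := #|_|%:R in sum_phi V0.
have up : \sum_(v : {ffun 'I_m -> bool}) \sum_r phi v r <= V * (w * W).
  rewrite /V mulr_natl -sumr_const; apply: ler_sum => v _; exact: phi_le.
have low : M * (V * (w * tau) / 2) <= \sum_(v : {ffun 'I_m -> bool}) \sum_r phi v r.
  rewrite exchange_big /= mulr_natl -[X in _ *+ X]card_ord -sumr_const.
  by apply: ler_sum => r _; exact: sum_phi.
rewrite -(ler_pM2l w0) -(ler_pM2l V0); have := le_trans low up; lra.
Qed.

End Assouad.

(** * Slow and fast tests applied to the PML distribution *)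

Section Tests.
Variable pml : forall n k : nat, {ffun 'I_n.+1 -> nat} -> 'I_k -> R.
Hypothesis pmlP : is_PML pml.
Variables (C c2 L : R).
Hypothesis C0 : 0 < C.
Hypothesis c2P : 0 < c2 < 1.
Hypothesis HL : forall f, lip01 R f -> (ereal_sup (log_ratios pml C c2 f n) <= L%:E)%E.

Local Notation q x := (@pml n m.+1 (profile x)).

Lemma pml_simplex (x : n.-tuple 'I_m.+1) : simplex R m.+1 (q x).
Proof. by case: (pmlP block_n_gt0 (ltn0Sn m) (ex_intro _ x erefl)). Qed.

(** A plug-in deviation [eps] is compared with minimax accuracy [eps / C], whence the rescaling. *)
Definition tail (eps : R) : R :=
  2 * expR (L - (1 - c2) * (n%:R * (eps / C) ^+ 2 / 32)).

Lemma tail_bound h p eps : (forall u u', `|h u - h u'| <= `|u - u'|) ->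
  0 < eps <= C -> simplex R m.+1 p ->
  iidE p (fun x : n.-tuple 'I_m.+1 =>
    (eps <= `|property (bernf n h) (q x) - property (bernf n h) p|)%R%:R)
  <= tail eps.
Proof.
move=> hL /andP[e0 eC] ps.
have := @PML_tail R pml C c2 L n m.+1 h (eps / C) p block_n_gt0 (ltn0Sn m) c2P HL hL.
rewrite mulrCA mulfV ?mulr1 ?gt_eqF // iid_probE; apply => //.
by rewrite divr_gt0 // ler_pdivrMr // mul1r.
Qed.

Lemma sign_le1 (b : bool) : `|(-1) ^+ b : R| <= 1.
Proof. by rewrite normrX normrN1 expr1n. Qed.

(** The prefactors here and in [fast_test] normalize to Lipschitz constant 1: by [disjoint_lip] the
    bare sums have constants [2 / rho] and 4. *)
Definition slow_test (s : {ffun 'I_m -> bool}) u : R :=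
  rho / 2 * \sum_r (-1) ^+ s r * plateau rho (y r) u.
Definition fast_test (s : {ffun 'I_m -> bool}) u : R :=
  4^-1 * \sum_r (-1) ^+ s r * fast w (y r) u.

Lemma slow_test_lip s u u' : `|slow_test s u - slow_test s u'| <= `|u - u'|.
Proof.
have r0 := gap_gt0; rewrite /slow_test -mulrBr normrM ger0_norm ?divr_ge0 ?(ltW r0) //.
have := @disjoint_lip R _ (fun r => plateau rho (y r)) (fun r => (-1) ^+ s r)
  rho^-1 u u' _ (fun r => sign_le1 (s r)) _ _.
move=> H; have {}H := H _ _ _.
rewrite mulrC -ler_pdivlMr ?divr_gt0 //; apply: le_trans (H _ _ _) _.
- by rewrite invr_ge0 ltW.
- by move=> r z z'; exact: plateau_lip.
- exact: plateau_disjoint.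
by rewrite le_eqVlt; apply/orP; left; apply/eqP; field; rewrite gt_eqF.
Qed.

Lemma fast_test_lip s u u' : `|fast_test s u - fast_test s u'| <= `|u - u'|.
Proof.
rewrite /fast_test -mulrBr normrM ger0_norm ?invr_ge0 //.
have := @disjoint_lip R _ (fun r => fast w (y r)) (fun r => (-1) ^+ s r)
  2 u u' (ler0n _ 2) (fun r => sign_le1 (s r)) (fun r => fast_lip w (y r)) fast_disjoint.
lra.
Qed.

Lemma property_slow_test s p :
  property (bernf n (slow_test s)) p = rho / 2 * \sum_r (-1) ^+ s r * Ssum r p.
Proof.
rewrite /property; under eq_bigr do rewrite bernfZ bernf_sum.
rewrite -mulr_sumr exchange_big /=; congr (_ * _); apply: eq_bigr => r _.
by rewrite mulr_sumr; apply: eq_bigr => j _; rewrite bernfZ.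
Qed.

Lemma property_fast_test s p :
  property (bernf n (fast_test s)) p = 4^-1 * \sum_r (-1) ^+ s r * Asum r p.
Proof.
rewrite /property; under eq_bigr do rewrite bernfZ bernf_sum.
rewrite -mulr_sumr exchange_big /=; congr (_ * _); apply: eq_bigr => r _.
by rewrite mulr_sumr; apply: eq_bigr => j _; rewrite bernfZ.
Qed.

Lemma card_signs : #|{: {ffun 'I_m -> bool}}| = (2 ^ m)%N.
Proof. by rewrite card_ffun card_bool card_ord. Qed.

(* A union bound over all sign patterns. *)
Lemma slow_dev v (t : R) : 0 < t -> rho / 2 * (t * M) <= C ->
  iidE (hypo v) (fun x => \sum_r `|Ssum r (q x) - Ssum r (hypo v)|) <=
  t * M + 4 * M * (2 ^+ m * tail (rho / 2 * (t * M))).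
Proof.
move=> t0 tC; have r0 := gap_gt0; have M0 := M_gt0; have ps := hypo_simplex v.
pose B s (x : n.-tuple 'I_m.+1) := rho / 2 * (t * M) <=
  `|property (bernf n (slow_test s)) (q x) - property (bernf n (slow_test s)) (hypo v)|.
have step x : \sum_r `|Ssum r (q x) - Ssum r (hypo v)| <=
    t * M + 4 * M * \sum_s (B s x)%:R.
  have B0 s : 0 <= (B s x)%:R :> R by rewrite ler0n.
  have [le|lt] := leP (\sum_r `|Ssum r (q x) - Ssum r (hypo v)|) (t * M).
    by rewrite (le_trans le) // lerDl mulr_ge0 ?sumr_ge0 // mulr_ge0 // ltW.
  (* These signs turn the signed sum into the absolute one. They depend on the sample, so every
     pattern has to be tested. *)
  pose s : {ffun 'I_m -> bool} := [ffun r => Ssum r (q x) - Ssum r (hypo v) < 0].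
  have Bs : B s x.
    rewrite /B !property_slow_test -mulrBr normrM ger0_norm ?divr_ge0 ?(ltW r0) //.
    rewrite ler_pM2l ?divr_gt0 // (le_trans (ltW lt)) // (le_trans _ (ler_norm _)) //.
    rewrite -sumrB; apply: ler_sum => r _; rewrite -mulrBr ffunE.
    by case: (ltP (Ssum r (q x) - Ssum r (hypo v)) 0) => h /=;
      [rewrite expr1 mulN1r ltr0_norm|rewrite expr0 mul1r ger0_norm].
  (* On the bad event the trivial bound [2 * (M + 1) <= 4 * M] suffices. *)
  have S4 : \sum_r `|Ssum r (q x) - Ssum r (hypo v)| <= 4 * M.
    apply: (@le_trans _ _ (\sum_r (Ssum r (q x) + Ssum r (hypo v)))).
      apply: ler_sum => r _; rewrite (le_trans (ler_normB _ _)) //.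
      by rewrite (ger0_norm (Ssum_ge0 r (pml_simplex x))) (ger0_norm (Ssum_ge0 r ps)).
    rewrite big_split /=; have := sum_Ssum_le (pml_simplex x).
    by have := sum_Ssum_le ps; have := M_ge1; lra.
  rewrite (le_trans S4) // -[leLHS]addr0 addrC lerD ?mulr_ge0 ?(ltW t0) ?(ltW M0) //.
  rewrite -[leLHS]mulr1 ler_wpM2l ?mulr_ge0 ?(ltW M0) //.
  by rewrite (bigD1 s) //= Bs lerDl sumr_ge0.
apply: (le_trans (iidE_le ps.1 step)).
rewrite iidED iidE_cst // iidEZ lerD2l ler_wpM2l ?mulr_ge0 ?(ltW M0) // iidE_sum.
rewrite -natrX -card_signs mulr_natl -sumr_const; apply: ler_sum => s _.
apply: tail_bound => //; first exact: slow_test_lip.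
by rewrite tC andbT !mulr_gt0 // invr_gt0.
Qed.

Lemma Asum_sign_le (s : {ffun 'I_m -> bool}) p : simplex R m.+1 p ->
  `|\sum_r (-1) ^+ s r * Asum r p| <= 2 * (w * M).
Proof.
move=> ps; have w0 := ltW scale_gt0.
have -> : \sum_r (-1) ^+ s r * Asum r p = \sum_j \sum_r (-1) ^+ s r * cfast r (p j).
  by rewrite exchange_big; apply: eq_bigr => r _; rewrite mulr_sumr.
apply: (@le_trans _ _ (\sum_(j < m.+1) w)).
  rewrite (le_trans (ler_norm_sum _ _ _)) //; apply: ler_sum => j _.
  have x01 := simplex01 j ps.
  rewrite (le_trans (ler_norm_sum _ _ _)) // (le_trans _ (sum_dfast_le x01)) //.
  apply: ler_sum => r _; rewrite normrM normrX normrN1 expr1n mul1r.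
  exact: cfast_le_dfast.
rewrite sumr_const card_ord -[leLHS]mulr_natr -natr1.
by have := ler_wpM2l w0 M_ge1; lra.
Qed.

(** The signs are those of the hypothesis, fixed before sampling, so a single test suffices and its
    threshold can be at the small scale [w]. *)
Lemma fast_dev (v : {ffun 'I_m -> bool}) (t : R) : 0 < t -> 4^-1 * (t * w * M) <= C ->
  iidE (hypo v) (fun x => \sum_r (-1) ^+ v r * (Asum r (hypo v) - Asum r (q x))) <=
  t * w * M + 4 * (w * M) * tail (4^-1 * (t * w * M)).
Proof.
move=> t0 tC; have w0 := scale_gt0; have M0 := M_gt0; have ps := hypo_simplex v.
have wM0 : 0 <= 4 * (w * M) by rewrite !mulr_ge0 // ltW.
pose B (x : n.-tuple 'I_m.+1) := 4^-1 * (t * w * M) <=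
  `|property (bernf n (fast_test v)) (q x) - property (bernf n (fast_test v)) (hypo v)|.
have step x : \sum_r (-1) ^+ v r * (Asum r (hypo v) - Asum r (q x)) <=
    t * w * M + 4 * (w * M) * (B x)%:R.
  have -> : \sum_r (-1) ^+ v r * (Asum r (hypo v) - Asum r (q x)) =
      \sum_r (-1) ^+ v r * Asum r (hypo v) - \sum_r (-1) ^+ v r * Asum r (q x).
    by rewrite -sumrB; apply: eq_bigr => r _; rewrite mulrBr.
  rewrite /B !property_fast_test -mulrBr normrM ger0_norm ?invr_ge0 //.
  rewrite ler_pM2l ?invr_gt0 // distrC.
  have := Asum_sign_le v ps; have := Asum_sign_le v (pml_simplex x).
  set a := \sum_r _; set b := \sum_r _; rewrite !ler_norml => /andP[? ?] /andP[? ?].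
  have tw : 0 <= t * w * M by rewrite !mulr_ge0 // ltW.
  case: (leP (t * w * M) `|b - a|) => h; first by rewrite mulr1; lra.
  by rewrite mulr0 addr0 (le_trans (ler_norm _)) // ltW.
apply: (le_trans (iidE_le ps.1 step)).
rewrite iidED iidE_cst // iidEZ lerD2l ler_wpM2l //.
apply: tail_bound => //; first exact: fast_test_lip.
by rewrite tC andbT pmulr_rgt0 ?invr_gt0 ?ltr0n // (mulr_gt0 (mulr_gt0 t0 w0) M0).
Qed.

(** The tail conditions make each bad event cost no more than its threshold, so [assouad] applies
    with [theta = delta = 2 * t]. *)
Lemma test_bound (t : R) : 0 < t -> rho / 2 * (t * M) <= C ->
  4^-1 * (t * w * M) <= C ->
  4 * (2 ^+ m * tail (rho / 2 * (t * M))) <= t ->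
  4 * tail (4^-1 * (t * w * M)) <= t ->
  M * (1 + expR 9216)^-1 / 2 <= M * (4 * t + 3 * eta) + 2 + 8 / (N * rho ^+ 2).
Proof.
move=> t0 tC1 tC2 ts tf; have M0 := M_gt0; have w0 := scale_gt0.
rewrite [4 * t](_ : _ = 2 * t + 2 * t); last by ring.
apply: (assouad pml_simplex) => v.
  apply: (le_trans (slow_dev v t0 tC1)).
  by have := ler_wpM2l (ltW M0) ts; lra.
apply: (le_trans (fast_dev v t0 tC2)).
by have := ler_wpM2l (ltW (mulr_gt0 w0 M0)) tf; lra.
Qed.

End Tests.
End Blocks.

(** * Choice of the constants and the contradiction *)

Lemma PML_log_ratio_ge (R : realType) pml (C c2 : R) :
  is_PML pml -> 0 < C -> 0 < c2 < 1 ->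
  exists B m0 kappa : R, [/\ 1 <= B, 0 < kappa & forall m n : nat,
    (0 < m)%N -> m0 <= m%:R -> B * m%:R ^+ 3 <= n%:R ->
    ((kappa * m%:R)%:E <=
      ereal_sup [set ereal_sup (log_ratios pml C c2 f n) | f in lip01 R])%E].
Proof.
move=> pmlP C0 c2P; have [c20 c21] := andP c2P.
have [tau [tau0 tauE]] : exists tau : R, 0 < tau /\ forall a, a / (1 + expR 9216) = a * tau.
  exists (1 + expR 9216)^-1; split; last by move=> a; reflexivity.
  by rewrite invr_gt0; exact: addr_gt0 ltr01 (expR_gt0 _).
(* Then [4 * t = tau / 16], well below the [tau / 2] of [test_bound]. *)
have [t tE] : exists t, t = tau / 64 by eexists.
have t0 : 0 < t by rewrite tE; apply: divr_gt0; rewrite // ltr0n.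
(* Chosen so that the fast exponent is exactly [2 * kappa * m]: half of it pays for
   [L = kappa * m]. *)
have [kappa kE] : exists kappa, kappa = (1 - c2) * t ^+ 2 / (64 * C ^+ 2) by eexists.
have k0 : 0 < kappa.
  rewrite kE.
  apply: divr_gt0; apply: mulr_gt0; rewrite ?exprn_gt0 ?ltr0n //.
  by rewrite subr_gt0.
have [b [b1 bE]] : exists b : R, 1 <= b /\ forall a, 256 * 256 * a = b * a.
  exists (256 * 256); split; last by move=> a; reflexivity.
  by rewrite -natrM ler1n muln_gt0.
(* [122 * 1024 = 3 * 10 * 4096 + 2048] collects the two terms of [test_bound] in [m ^+ 3 / n]; the
   factor 16 reduces them to [m * tau / 16]. *)
have [K [K0 KE]] : exists K : R, 0 < K /\ forall a, 122 * 1024 * 16 * a = K * a.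
  exists (122 * 1024 * 16); split; last by move=> a; reflexivity.
  by rewrite -!natrM ltr0n !muln_gt0.
have B1 : 0 <= 1024 + 512 / kappa.
  by apply: addr_ge0; [exact: ler0n|apply: divr_ge0; [exact: ler0n|exact: ltW]].
have B2 : 0 <= K / tau by apply: divr_ge0; exact: ltW.
have e1 : 0 <= 32 / tau by apply: divr_ge0; [exact: ler0n|exact: ltW].
have e2 : 0 <= t / C by rewrite divr_ge0 // ltW.
have tk0 : 0 < t * kappa by rewrite mulr_gt0.
have e3 : 0 <= 8 / (t * kappa) by apply: divr_ge0; [exact: ler0n|exact: ltW].
(* The three bounds serve, in order, the separation of scales, the union over sign patterns, and the
   smallness of the terms in [m ^+ 3 / n]. *)
have [B [BA Bk BK]] : exists B, [/\ b <= B, 1024 + 512 / kappa <= B & K / tau <= B].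
  move: B1 B2 b1; move: (1024 + _) (K / tau) => a1 a2; clear; move=> *.
  by exists (b + a1 + a2); split; lra.
have B_ge1 : 1 <= B := le_trans b1 BA.
(* In order: the additive 2 is absorbed, the thresholds stay below [C], and the residual tail falls
   below [t]. *)
have [m0 [mA mt mk]] : exists m0, [/\ 32 / tau <= m0, t / C <= m0 & 8 / (t * kappa) <= m0].
  move: e1 e2 e3; move: (32 / tau) (t / C) (8 / (t * kappa)) => a1 a2 a3; clear; move=> *.
  by exists (a1 + a2 + a3); split; lra.
exists B, m0, kappa; split; [exact: B_ge1|exact: k0|move=> m n m_gt0 mm0 mn].
rewrite leNgt; apply/negP => lt_sup.
have HL f : lip01 R f ->
    (ereal_sup (log_ratios pml C c2 f n) <= (kappa * m%:R)%:E)%E.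
  move=> Lf; apply: le_trans (ltW lt_sup); apply: ereal_sup_ubound; exists f => //.
have M0 : 0 < m%:R :> R by rewrite ltr0n.
have M3 : 0 < m%:R ^+ 3 :> R by rewrite exprn_gt0.
have mn' : 256 * 256 * m%:R ^+ 3 <= n%:R :> R.
  by apply: le_trans mn; rewrite bE (ler_pM2r M3).
have N0 : 0 < n%:R :> R by rewrite ltr0n (block_n_gt0 m_gt0 mn').
have M1 : 1 <= m%:R :> R by rewrite ler1n.
have w0 := scale_gt0 m_gt0 mn'.
have tM : t <= C * m%:R.
  by rewrite mulrC -ler_pdivrMr //; apply: le_trans mm0.
have wM : scale R m n * m%:R <= (64 * m%:R)^-1.
  have := ler_wpM2r (ltW M0) (scale_le_gap m_gt0 mn').
  rewrite (_ : gap R m / 4 * m%:R = (64 * m%:R)^-1) //.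
  by rewrite /gap; field; rewrite gt_eqF.
have small : 8 * expR (- (kappa * m%:R)) <= t.
  have km : 0 < kappa * m%:R by rewrite mulr_gt0.
  rewrite expRN ler_pdivrMr ?expR_gt0 //.
  apply: (@le_trans _ _ (t * (1 + kappa * m%:R))); last first.
    by rewrite ler_pM2l // expR_ge1Dx.
  have := le_trans mk mm0; rewrite (ler_pdivrMr _ _ tk0) => h.
  apply: (le_trans h); rewrite (_ : _ * (1 + _) = t + m%:R * (t * kappa)); last by ring.
  by rewrite lerDr ltW.
have := @test_bound R m n m_gt0 mn' pml pmlP C c2 (kappa * m%:R) C0 c2P HL t t0 _ _ _ _.
rewrite tauE.
have -> : gap R m / 2 * (t * m%:R) = t / (32 * m%:R).
  by rewrite /gap; field; rewrite gt_eqF.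
have tail2 : tail n C c2 (kappa * m%:R) (4^-1 * (t * scale R m n * m%:R)) =
    2 * expR (- (kappa * m%:R)).
  rewrite /tail; congr (_ * expR _).
  rewrite (_ : (_ / C) ^+ 2 = t ^+ 2 * scale R m n ^+ 2 * m%:R ^+ 2 / (16 * C ^+ 2)); last first.
    by field; rewrite gt_eqF.
  by rewrite scale_sqr kE; field; rewrite !gt_eqF.
(* The slow exponent is at least [(2 * kappa + 1) * m]: one [m] pays for the [2 ^+ m <= expR m]
   patterns, one [kappa * m] for [L], and the other remains. *)
have tail1 : 2 ^+ m * tail n C c2 (kappa * m%:R) (t / (32 * m%:R)) <=
    2 * expR (- (kappa * m%:R)).
  rewrite /tail mulrCA ler_pM2l //.
  apply: (@le_trans _ _ (expR m%:R * expR (kappa * m%:R -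
     (1 - c2) * (n%:R * (t / (32 * m%:R) / C) ^+ 2 / 32)))).
    rewrite ler_wpM2r ?expR_ge0 // -[m%:R in leRHS]mulr1 expRM_natl.
    by apply: lerXn2r; rewrite ?nnegrE ?expR_ge0 // (le_trans _ (expR_ge1Dx _)).
  rewrite -expRD ler_expR.
  have -> : (1 - c2) * (n%:R * (t / (32 * m%:R) / C) ^+ 2 / 32) =
      kappa * n%:R / (512 * m%:R ^+ 2).
    by rewrite kE; field; rewrite !gt_eqF.
  have h : kappa * (B * m%:R ^+ 3) / (512 * m%:R ^+ 2) <=
      kappa * n%:R / (512 * m%:R ^+ 2).
    apply: ler_wpM2r; last by rewrite ler_pM2l.
    by rewrite invr_ge0; apply: mulr_ge0; [exact: ler0n|exact: sqr_ge0].
  rewrite (_ : _ / _ = kappa * B * (m%:R / 512)) in h; last by field; rewrite gt_eqF.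
  have kB : (2 * kappa + 1) * m%:R <= kappa * B * (m%:R / 512).
    rewrite (_ : _ * m%:R = (512 * (2 * kappa + 1)) * (m%:R / 512)); last by field.
    apply: ler_wpM2r; first by apply: divr_ge0; exact: ler0n.
    rewrite (_ : 512 * _ = kappa * (1024 + 512 / kappa)); first by rewrite ler_pM2l.
    by field; rewrite gt_eqF.
  have := le_trans kB h; move: (kappa * n%:R / _) => z; clear; lra.
move=> H; have {}H := H _ _ _ _; move: H.
have -> : 8 / (n%:R * gap R m ^+ 2) = 2048 * m%:R * (m%:R ^+ 3 / n%:R) :> R.
  by rewrite /gap; field; rewrite !gt_eqF.
rewrite scale_gap //.
have r0 : m%:R ^+ 3 / n%:R <= tau / K.
  rewrite ler_pdivrMr // mulrAC ler_pdivlMr // mulrC.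
  apply: (@le_trans _ _ (tau * (B * m%:R ^+ 3))); last by rewrite (ler_pM2l tau0).
  by rewrite [tau * _]mulrA (ler_pM2r M3) [tau * B]mulrC -ler_pdivrMr.
move: (m%:R ^+ 3 / n%:R) r0 => r r0.
have {r0}Mr : K * (m%:R * r) <= m%:R * tau.
  by rewrite mulrCA ler_pM2l // mulrC -ler_pdivlMr.
rewrite -KE {KE} in Mr.
have Mt : 32 <= m%:R * tau.
  by rewrite -ler_pdivrMr //; apply: le_trans mm0.
clear tauE bE HL lt_sup; move=> H; suff : m%:R * tau / 2 <=
    m%:R * (4 * t + 3 * (10 * (4096 * r))) + 2 + 2048 * m%:R * r.
  by rewrite tE; lra.
apply: H.
- rewrite ler_pdivrMr ?mulr_gt0 //; lra.
- have h : t / (64 * m%:R) <= C.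
    by rewrite ler_pdivrMr ?(mulr_gt0 _ M0) ?ltr0n //; have := mulr_ge0 (ltW C0) (ltW M0); lra.
  by have := ler_wpM2l (ltW t0) wM; lra.
- by rewrite (le_trans (ler_wpM2l _ tail1)) //; lra.
- by rewrite tail2; lra.
Qed.

(** * Passage to the limit *)

Local Open Scope ereal_scope.

Theorem theorem2 (R : realType) (C c1 c2 : R)
    (C_gt0 : (0 < C)%R)
    (c1_gt0 : (0 < c1)%R) (c1_lt : (c1 < 1 / 3)%R)
    (c2_gt0 : (0 < c2)%R) (c2_lt1 : (c2 < 1)%R)
    (pml : forall n k : nat, {ffun 'I_n.+1 -> nat} -> 'I_k -> R)
    (pmlP : is_PML pml) :
  limn_einf (fun n : nat =>
    (n%:R `^ (- (1 / 3 - c1)))%:E *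
    ereal_sup [set ereal_sup (log_ratios pml C c2 f n) | f in lip01 R]) = +oo.
Proof.
have c2P : (0 < c2 < 1)%R by rewrite c2_gt0.
have cN0 := lt0r_neq0 c1_gt0.
have [B [m0 [kappa [B1 k0 H]]]] := PML_log_ratio_ge pmlP C_gt0 c2P.
have B0 : (0 < B)%R by apply: lt_le_trans B1.
have BN0 := lt0r_neq0 B0.
apply: (cvg_limn_einf_sup _).1; apply/cvgeyPge => A.
(* Once n^c1 reaches [Y], the first summand gives [m >= m0] and [m > 0], and the second makes the
   normalized value at least [A]. *)
pose Y := (B * (2 + `|m0|) + 2 * B * `|A| / kappa)%R.
have Ym : (B * (2 + `|m0|) <= Y)%R.
  by rewrite lerDl divr_ge0 ?(ltW k0) // mulr_ge0 // mulr_ge0 // ltW.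
have Y1 : (1 <= Y)%R.
  by apply: le_trans Ym; have := normr_ge0 m0; nra.
have YA : (A <= kappa * (Y / (2 * B)))%R.
  have -> : (kappa * (Y / (2 * B)) = kappa * (2 + `|m0|) / 2 + `|A|)%R.
    by rewrite /Y; field; rewrite !gt_eqF.
  rewrite (le_trans (ler_norm A)) // lerDr.
  by apply: divr_ge0 => //; apply: mulr_ge0; [exact: ltW|exact: addr_ge0].
exists (Num.truncn (Y `^ c1^-1)).+1 => // n /=.
rewrite -(ler_nat R) => /(lt_le_trans (truncnS_gt _))/ltW nY.
have n1 : (1 <= n%:R :> R)%R.
  by apply: le_trans nY; rewrite -(powRr0 Y) ler_powR // invr_ge0 ltW.
have ncY : (Y <= n%:R `^ c1)%R.
  have -> : Y = (Y `^ c1^-1 `^ c1)%R.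
    by rewrite -powRrM mulVf // powRr1 // (le_trans _ Y1).
  by apply: ge0_ler_powR; rewrite ?nnegrE ?powR_ge0 ?ler0n ?(ltW c1_gt0).
have nx : (n%:R `^ c1 <= n%:R `^ (1 / 3))%R by rewrite ler_powR // ltW.
set x := (n%:R `^ (1 / 3))%R in nx.
have x3 : (x ^+ 3 = n%:R)%R.
  by rewrite -powR_mulrn ?powR_ge0 // -powRrM mul1r mulVf // powRr1.
have xB : (2 + `|m0| <= x / B)%R.
  by rewrite ler_pdivlMr // mulrC (le_trans Ym) // (le_trans ncY).
have xB0 : (0 <= x / B)%R by rewrite divr_ge0 ?powR_ge0 // ltW.
(* With x = n^(1/3), [B >= 1] gives [B * m ^+ 3 <= (B * m) ^+ 3 <= n], while [x / B >= 2] keeps [m]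
   above [x / (2 * B)] despite the truncation. *)
pose m := Num.truncn (x / B).
have /andP[mx xm] := truncn_itv xB0; rewrite -/m -natr1 in mx xm.
have am0 := normr_ge0 m0; have lm0 := ler_norm m0.
have m_gt0 : (0 < m)%N by rewrite -(ltr0n R); lra.
have Bm : (B * m%:R ^+ 3 <= n%:R)%R.
  rewrite -x3 -[x in leRHS](divfK BN0) exprMn mulrC.
  have B13 : (B <= B ^+ 3)%R by apply: ler_eXnr.
  have mx3 : (m%:R ^+ 3 <= (x / B) ^+ 3)%R by apply: lerXn2r; rewrite ?nnegrE.
  exact: (ler_pM (exprn_ge0 _ (ler0n _ _)) (ltW B0) mx3 B13).
have mm0 : (m0 <= m%:R)%R by lra.
have nN0 : n%:R != 0%R :> R by rewrite gt_eqF // (lt_le_trans _ n1).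
have e0 : (0 <= n%:R `^ (- (1 / 3 - c1)))%R by rewrite powR_ge0.
apply: (@le_trans _ _ ((n%:R `^ (- (1 / 3 - c1)))%:E * (kappa * m%:R)%:E)); last first.
  by rewrite lee_wpmul2l ?lee_fin //; exact: H.
rewrite -EFinM lee_fin (le_trans YA) //.
rewrite [leRHS]mulrCA (ler_pM2l k0).
apply: (@le_trans _ _ (n%:R `^ (- (1 / 3 - c1)) * (x / (2 * B)))%R); last first.
  apply: ler_wpM2l => //; rewrite invfM mulrCA; lra.
have -> : (n%:R `^ (- (1 / 3 - c1)) * (x / (2 * B)) = n%:R `^ c1 / (2 * B))%R.
  rewrite mulrA -powRD; last by rewrite nN0 implybT.
  by congr (_ `^ _ / _)%R; ring.
by apply: ler_wpM2r => //; rewrite invr_ge0 mulr_ge0 // ltW.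
Qed.
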